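(* The class $\mathsf{ID}[2]$ of frontier-two inclusion dependencies is destructive of arity-two QA. In particular, QA is undecidable for the class $\mathsf{ID}[2] \wedge \mathcal{D}$ of conjunctions of $\mathsf{ID}[2]$ rules on $\sigma$ and $\mathcal{D}$ constraints on $\sigma_{\leq 2}$, for any description logic $\mathcal{D}$ that features functionality assertions $\mathrm{funct}(R)$ for binary relations $R$.
   Context: A signature $\sigma$ is a finite set of relation names with arities; $\sigma_{\leq 2}$ and $\sigma_{>2}$ denote its relations of arity $\leq 2$ and $>2$. Atoms use variables only (no constants). A $\sigma$-fact is a finite conjunction of atoms over $\sigma$. A CQ is an existentially quantified finite conjunction of atoms without free variables. Interpretations are relational structures, finite or infinite. QA (query answering) for a class of constraints: given (as input) a signature, a fact $F$, constraints $\Theta$ of the class and a CQ $q$, decide whether $\forall \mathbf{x}~(F(\mathbf{x}) \wedge \Theta \rightarrow q)$ is valid over all interpretations. An existential rule is a sentence $\forall \mathbf{x}~(\phi(\mathbf{x}) \rightarrow \exists \mathbf{y}~\psi(\mathbf{x'},\mathbf{y}))$ with $\mathbf{x'} \subseteq \mathbf{x}$, where $\phi$ (body) and $\psi$ (head) are conjunctions of atoms without equality or constants; its frontier is the set $\mathbf{x'}$ of variables occurring in both body and head. An inclusion dependency is an existential rule whose body and head are single atoms in each of which every variable is used only once, and whose frontier is non-empty. $\mathsf{ID}[2]$ is the class of inclusion dependencies whose frontier has size $2$. A description logic is an arity-two constraint language (its constraints only use relations of $\sigma_{\leq 2}$). The functionality assertion $\mathrm{funct}(R)$ for a binary relation $R$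 is $\forall x\, y\, y'~(R(x,y) \wedge R(x,y') \rightarrow y = y')$. $\mathsf{GC}^2$ (two-variable guarded fragment with counting) is the smallest class of constant-free first-order formulas with at most two variables that contains all atoms for relations of $\sigma_{\leq 2}$ and is closed under Boolean connectives, under guarded universal and existential quantification (guarded by an atom containing all free variables of the quantified formula), and under number quantification $\exists^{\geq n} y~A(x,y) \wedge \phi(x,y)$ and $\exists^{<n} y~A(x,y) \wedge \phi(x,y)$ with $A(x,y)$ an arity-two atom with two free variables. A class of existential rules is destructive (of arity-two QA) if QA is undecidable for conjunctions of rules of the class (on $\sigma$) and $\mathsf{GC}^2$ constraints (on $\sigma_{\leq 2}$). *)

(* Defs.v *)
From HB Require Import structures.
From mathcomp Require Import all_boot.

Set Implicit Arguments.
Unset Strict Implicit.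
Unset Printing Implicit Defensive.

Inductive recfun : nat -> Type :=
| RZero n : recfun n
| RSucc : recfun 1
| RProj n (i : 'I_n) : recfun n
| RComp m n (f : recfun m) (g : 'I_m -> recfun n) : recfun n
| RRec n (f : recfun n) (g : recfun n.+2) : recfun n.+1
| RMin n (f : recfun n.+1) : recfun n.

(** [rec_eval f v y]: the computation of [f] on [v] terminates with value [y].
    The recursion argument of [RRec] and the minimised argument of [RMin] come
    first; the step function of [RRec] receives the predecessor, the previous
    value, and the parameters. *)
Fixpoint rec_eval n (f : recfun n) : n.-tuple nat -> nat -> Prop :=
  match f in recfun n return n.-tuple nat -> nat -> Prop with
  | RZero _ => fun _ y => y = 0
  | RSucc => fun v y => y = (thead v).+1
  | RProj _ i => fun v y => y = tnth v i
  | RComp m _ f g => fun v y =>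
      exists2 w : m.-tuple nat,
        forall i, rec_eval (g i) v (tnth w i) & rec_eval f w y
  | RRec _ f g => fun v =>
      let p := behead_tuple v in
      (fix loop (k : nat) (y : nat) : Prop :=
         if k is k'.+1
         then exists2 z, loop k' z & rec_eval g (cons_tuple k' (cons_tuple z p)) y
         else rec_eval f p y) (thead v)
  | RMin _ f => fun v y =>
      rec_eval f (cons_tuple y v) 0 /\
      forall z, z < y -> exists t, rec_eval f (cons_tuple z v) t.+1
  end.

(** The promise problem with inputs [A] and yes-instances [P]. Inputs are
    presented to the algorithm through the Goedel numbering [pickle]; nothing
    is required of the algorithm outside [A]. *)
Definition recursively_decidable (T : countType) (A P : T -> Prop) : Prop :=
  exists f : recfun 1, forall x : T, A x ->
    (P x -> rec_eval f [tuple pickle x] 1) /\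
    (~ P x -> rec_eval f [tuple pickle x] 0).

(** The relation names of [sig] are the [r < size sig], of arity [nth 0 sig r]. *)
Definition signature := seq nat.
Definition arity (sig : signature) (r : nat) : nat := nth 0 sig r.

Definition atom (V : Type) := (nat * seq V)%type.

Definition atom_over (V : Type) (sig : signature) (a : atom V) : bool :=
  (a.1 < size sig) && (size a.2 == arity sig a.1).

(** [interp_rel r] is only ever consulted on tuples whose length is the arity of [r]. *)
Record interp := Interp {
  domain : Type;
  domain_inhabited : inhabited domain;
  interp_rel : nat -> seq domain -> Prop
}.

Definition atom_sat (I : interp) (V : Type) (v : V -> domain I) (a : atom V) : Prop :=
  interp_rel a.1 (map v a.2).

Definition conjunction := seq (atom nat).

Definition conj_sat (I : interp) (v : nat -> domain I) (A : conjunction) : Prop :=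
  forall a, a \in A -> atom_sat v a.

Definition conj_vars (A : conjunction) : seq nat := flatten [seq a.2 | a <- A].

(** Facts are conjunctions; the Boolean conjunctive query [q] is the existential
    closure of the conjunction [q]. *)
Definition cq_sat (I : interp) (q : conjunction) : Prop :=
  exists v : nat -> domain I, conj_sat v q.

(** A rule is a pair (body, head). *)
Definition rule := (conjunction * conjunction)%type.

Definition rule_over (sig : signature) (r : rule) : bool :=
  all (atom_over sig) r.1 && all (atom_over sig) r.2.

Definition frontier (r : rule) : seq nat :=
  undup [seq x <- conj_vars r.1 | x \in conj_vars r.2].

Definition rule_sat (I : interp) (r : rule) : Prop :=
  forall v : nat -> domain I, conj_sat v r.1 ->
  exists w : nat -> domain I,
    {in frontier r, forall x, w x = v x} /\ conj_sat w r.2.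

Definition inclusion_dependency (r : rule) : bool :=
  if r is ([:: a], [:: b])
  then [&& uniq a.2, uniq b.2 & 0 < size (frontier r)]
  else false.

Definition ID2 (r : rule) : bool :=
  inclusion_dependency r && (size (frontier r) == 2).

Record arity_two_language := ArityTwoLanguage {
  constraint : countType;
  constraint_over : signature -> constraint -> Prop;
  constraint_sat : interp -> constraint -> Prop;
  (** only the relations of [sig] of arity at most two matter *)
  constraint_local :
    forall (sig : signature) (c : constraint), constraint_over sig c ->
    forall (D : Type) (hD : inhabited D) (P Q : nat -> seq D -> Prop),
    (forall r s, r < size sig -> arity sig r <= 2 -> size s = arity sig r ->
       (P r s <-> Q r s)) ->
    (constraint_sat (Interp hD P) c <-> constraint_sat (Interp hD Q) c)
}.

Definition functional (I : interp) (R : nat) : Prop :=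
  forall x y y' : domain I,
    interp_rel R [:: x; y] -> interp_rel R [:: x; y'] -> y = y'.

Definition features_functionality (L : arity_two_language) : Prop :=
  exists funct : nat -> constraint L,
  forall (sig : signature) (R : nat), R < size sig -> arity sig R = 2 ->
    constraint_over sig (funct R) /\
    forall I : interp, constraint_sat I (funct R) <-> functional I R.

(** The two variables are the Booleans. [GAll zs A phi] is
    "forall zs (A -> phi)" and [GEx zs A phi] is "exists zs (A /\ phi)", for a
    block [zs] of quantified variables; [GAtLeast n z A phi] and
    [GLess n z A phi] are the number quantifications over [z] of "A /\ phi". *)
Inductive gc2 :=
| GAtom (A : atom bool)
| GNot (phi : gc2)
| GAnd (phi psi : gc2)
| GOr (phi psi : gc2)
| GImp (phi psi : gc2)
| GAll (zs : seq bool) (A : atom bool) (phi : gc2)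
| GEx (zs : seq bool) (A : atom bool) (phi : gc2)
| GAtLeast (n : nat) (z : bool) (A : atom bool) (phi : gc2)
| GLess (n : nat) (z : bool) (A : atom bool) (phi : gc2).

Fixpoint gc2_tree (phi : gc2) : GenTree.tree (atom bool) :=
  match phi with
  | GAtom A => GenTree.Leaf A
  | GNot f => GenTree.Node 0 [:: gc2_tree f]
  | GAnd f g => GenTree.Node 1 [:: gc2_tree f; gc2_tree g]
  | GOr f g => GenTree.Node 2 [:: gc2_tree f; gc2_tree g]
  | GImp f g => GenTree.Node 3 [:: gc2_tree f; gc2_tree g]
  | GAll zs A f =>
      GenTree.Node 4 [:: GenTree.Leaf (0, zs); GenTree.Leaf A; gc2_tree f]
  | GEx zs A f =>
      GenTree.Node 5 [:: GenTree.Leaf (0, zs); GenTree.Leaf A; gc2_tree f]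
  | GAtLeast n z A f =>
      GenTree.Node 6 [:: GenTree.Leaf (n, [:: z]); GenTree.Leaf A; gc2_tree f]
  | GLess n z A f =>
      GenTree.Node 7 [:: GenTree.Leaf (n, [:: z]); GenTree.Leaf A; gc2_tree f]
  end.

Fixpoint tree_gc2 (t : GenTree.tree (atom bool)) : option gc2 :=
  match t with
  | GenTree.Leaf A => Some (GAtom A)
  | GenTree.Node 0 [:: f] => omap GNot (tree_gc2 f)
  | GenTree.Node 1 [:: f; g] =>
      obind (fun x => omap (GAnd x) (tree_gc2 g)) (tree_gc2 f)
  | GenTree.Node 2 [:: f; g] =>
      obind (fun x => omap (GOr x) (tree_gc2 g)) (tree_gc2 f)
  | GenTree.Node 3 [:: f; g] =>
      obind (fun x => omap (GImp x) (tree_gc2 g)) (tree_gc2 f)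
  | GenTree.Node 4 [:: GenTree.Leaf zs; GenTree.Leaf A; f] =>
      omap (GAll zs.2 A) (tree_gc2 f)
  | GenTree.Node 5 [:: GenTree.Leaf zs; GenTree.Leaf A; f] =>
      omap (GEx zs.2 A) (tree_gc2 f)
  | GenTree.Node 6 [:: GenTree.Leaf (n, [:: z]); GenTree.Leaf A; f] =>
      omap (GAtLeast n z A) (tree_gc2 f)
  | GenTree.Node 7 [:: GenTree.Leaf (n, [:: z]); GenTree.Leaf A; f] =>
      omap (GLess n z A) (tree_gc2 f)
  | _ => None
  end.

Lemma gc2_treeK : pcancel gc2_tree tree_gc2.
Proof.
by elim=> [A|f IHf|f IHf g IHg|f IHf g IHg|f IHf g IHg|zs A f IHf|zs A f IHf
  |n z A f IHf|n z A f IHf] //=; rewrite ?IHf //= ?IHg.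
Qed.

HB.instance Definition _ := Countable.copy gc2 (pcan_type gc2_treeK).

Fixpoint gc2_free (phi : gc2) : seq bool :=
  match phi with
  | GAtom A => A.2
  | GNot f => gc2_free f
  | GAnd f g | GOr f g | GImp f g => gc2_free f ++ gc2_free g
  | GAll zs A f | GEx zs A f => [seq z <- A.2 ++ gc2_free f | z \notin zs]
  | GAtLeast _ z A f | GLess _ z A f =>
      [seq z' <- A.2 ++ gc2_free f | z' != z]
  end.

Definition gc2_atom_over (sig : signature) (A : atom bool) : bool :=
  atom_over sig A && (size A.2 <= 2).

(** The formulas of the fragment over the relations of [sig] of arity at most
    two: guards contain all free variables of the quantified formula, and the
    guard of a number quantification is binary with two distinct variables. *)
Fixpoint gc2_over (sig : signature) (phi : gc2) : bool :=
  match phi with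
  | GAtom A => gc2_atom_over sig A
  | GNot f => gc2_over sig f
  | GAnd f g | GOr f g | GImp f g => gc2_over sig f && gc2_over sig g
  | GAll _ A f | GEx _ A f =>
      [&& gc2_atom_over sig A, all (mem A.2) (gc2_free f) & gc2_over sig f]
  | GAtLeast _ _ A f | GLess _ _ A f =>
      [&& gc2_atom_over sig A, size A.2 == 2, uniq A.2 & gc2_over sig f]
  end.

Definition upd (D : Type) (v : bool -> D) (z : bool) (d : D) : bool -> D :=
  fun z' => if z' == z then d else v z'.

Definition at_least (D : Type) (n : nat) (P : D -> Prop) : Prop :=
  exists g : 'I_n -> D, injective g /\ forall i, P (g i).

Fixpoint gc2_sat (I : interp) (v : bool -> domain I) (phi : gc2) : Prop :=
  match phi with
  | GAtom A => atom_sat v A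
  | GNot f => ~ gc2_sat v f
  | GAnd f g => gc2_sat v f /\ gc2_sat v g
  | GOr f g => gc2_sat v f \/ gc2_sat v g
  | GImp f g => gc2_sat v f -> gc2_sat v g
  | GAll zs A f => forall w : bool -> domain I,
      (forall z, z \notin zs -> w z = v z) -> atom_sat w A -> gc2_sat w f
  | GEx zs A f => exists w : bool -> domain I,
      [/\ forall z, z \notin zs -> w z = v z, atom_sat w A & gc2_sat w f]
  | GAtLeast n z A f =>
      at_least n (fun d => atom_sat (upd v z d) A /\ gc2_sat (upd v z d) f)
  | GLess n z A f =>
      ~ at_least n (fun d => atom_sat (upd v z d) A /\ gc2_sat (upd v z d) f)
  end.

Definition gc2_sentence_over (sig : signature) (phi : gc2) : Prop :=
  gc2_over sig phi /\ gc2_free phi = [::].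

Definition gc2_sentence_sat (I : interp) (phi : gc2) : Prop :=
  forall v : bool -> domain I, gc2_sat v phi.

Lemma at_least_iff (D : Type) n (P Q : D -> Prop) :
  (forall d, P d <-> Q d) -> at_least n P <-> at_least n Q.
Proof.
by move=> PQ; split=> -[g [gi gP]]; exists g; split=> // i; apply/PQ.
Qed.

Lemma gc2_local (sig : signature) (c : gc2) : gc2_sentence_over sig c ->
  forall (D : Type) (hD : inhabited D) (P Q : nat -> seq D -> Prop),
  (forall r s, r < size sig -> arity sig r <= 2 -> size s = arity sig r ->
     (P r s <-> Q r s)) ->
  (gc2_sentence_sat (Interp hD P) c <-> gc2_sentence_sat (Interp hD Q) c).
Proof.
move=> [c_over _] D hD P Q PQ.
have atomP A (v : bool -> D) : gc2_atom_over sig A ->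
    @atom_sat (Interp hD P) _ v A <-> @atom_sat (Interp hD Q) _ v A.
  case/andP=> /andP[ltA /eqP szA] leA; apply: PQ => //.
    by rewrite -szA.
  by rewrite size_map.
suff satP (v : bool -> D) :
    @gc2_sat (Interp hD P) v c <-> @gc2_sat (Interp hD Q) v c.
  by split=> sat v; apply/satP.
elim: c c_over v => /= [A|f IHf|f IHf g IHg|f IHf g IHg|f IHf g IHg
  |zs A f IHf|zs A f IHf|n z A f IHf|n z A f IHf].
- by move=> oA v; apply: atomP.
- by move=> /IHf Hf v; move: (Hf v); tauto.
- by move=> /andP[/IHf Hf /IHg Hg] v; move: (Hf v) (Hg v); tauto.
- by move=> /andP[/IHf Hf /IHg Hg] v; move: (Hf v) (Hg v); tauto.
- by move=> /andP[/IHf Hf /IHg Hg] v; move: (Hf v) (Hg v); tauto.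
- move=> /and3P[oA _ /IHf Hf] v.
  by split=> H w wv /(atomP _ _ oA) wA; apply/Hf; apply: H.
- move=> /and3P[oA _ /IHf Hf] v.
  by split=> -[w [wv /(atomP _ _ oA) wA /Hf wf]]; exists w.
- move=> /and4P[oA _ _ /IHf Hf] v; apply: at_least_iff => d.
  by move: (atomP _ (upd v z d) oA) (Hf (upd v z d)); tauto.
- move=> /and4P[oA _ _ /IHf Hf] v.
  have PQd d : @atom_sat (Interp hD P) _ (upd v z d) A /\
        @gc2_sat (Interp hD P) (upd v z d) f <->
      @atom_sat (Interp hD Q) _ (upd v z d) A /\
        @gc2_sat (Interp hD Q) (upd v z d) f.
    by move: (atomP _ (upd v z d) oA) (Hf (upd v z d)); tauto.
  by move: (at_least_iff n PQd); tauto.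
Qed.

Definition GC2 : arity_two_language := ArityTwoLanguage gc2_local.

(** An instance consists of a signature, a fact, existential rules and
    arity-two constraints (both read as conjunctions), and a Boolean CQ. *)
Definition qa_instance (L : arity_two_language) : countType :=
  (signature * conjunction * seq rule * seq (constraint L) * conjunction)%type.

Definition qa_input (C : rule -> bool) (L : arity_two_language)
    (x : qa_instance L) : Prop :=
  let: (sig, F, rules, cs, q) := x in
  [/\ all (atom_over sig) F,
      all (fun r => C r && rule_over sig r) rules,
      forall c, c \in cs -> constraint_over sig c
    & all (atom_over sig) q].

Definition qa_valid (L : arity_two_language) (x : qa_instance L) : Prop :=
  let: (sig, F, rules, cs, q) := x in
  forall (I : interp) (v : nat -> domain I),
    conj_sat v F ->
    (forall r, r \in rules -> rule_sat I r) ->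
    (forall c, c \in cs -> constraint_sat I c) ->
    cq_sat I q.

Definition qa_undecidable (C : rule -> bool) (L : arity_two_language) : Prop :=
  ~ recursively_decidable (qa_input C (L := L)) (@qa_valid L).

Definition destructive (C : rule -> bool) : Prop := qa_undecidable C GC2.

(* Main.v *)
Require Import Defs.
From mathcomp Require Import all_boot.
From mathcomp Require Import zify.
From Stdlib Require Import Classical ClassicalEpsilon FunctionalExtensionality.

(** A counter machine P is turned into an instance of query answering whose
    query is entailed iff P halts. Grid points stand for register contents:
    functional relations H_i increment register i and commute. Functional
    relations C_l map a point v to a "status" of the configuration (l, v), and
    each instruction equates the statuses of a configuration and its successor;
    a zero test is available because points whose register i is 0 are
    generated along their own relation Z_i. The query asks whether the status
    of the initial configuration is also that of a final one. If P does not
    halt, the countermodel consists of the register contents and of two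
    statuses, "halts" and "does not halt".

    These rules have one binary body atom and several binary head atoms. Such a
    rule is expressed by frontier-two inclusion dependencies: the body implies
    an auxiliary 6-ary atom, which implies each head atom.

    If f decided query answering, a machine P could read four numbers meant to
    be the codes of the signature, the rules, the constraints and the query of
    its own instance, compute the code of that instance (the fact only lists
    the four numbers in unary), and halt iff f returns 0. Run on the codes of
    its own instance, P contradicts f. *)

Set Implicit Arguments.
Unset Strict Implicit.
Unset Printing Implicit Defensive.

(** * Compiling recursive functions to while programs *)

Definition regs := nat -> nat.

Definition setr (v : regs) (i n : nat) : regs := fun j => if j == i then n else v j.

Ltac regs_ext :=
  apply: functional_extensionality => ?; rewrite /setr;
  repeat (case: eqP => ?); subst; try congruence; try lia.

(** A loop tests and decrements its register before each pass, so that it compiles to one [Dec] and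
    one backward jump. *)
Inductive prog :=
| Skip
| Incr (i : nat)
| Seq (p q : prog)
| Loop (i : nat) (p : prog).

Inductive exec : prog -> regs -> regs -> Prop :=
| ExecSkip v : exec Skip v v
| ExecIncr i v : exec (Incr i) v (setr v i (v i).+1)
| ExecSeq p q v1 v2 v3 : exec p v1 v2 -> exec q v2 v3 -> exec (Seq p q) v1 v3
| ExecLoop0 i p v : v i = 0 -> exec (Loop i p) v v
| ExecLoopS i p v1 v2 v3 n : v1 i = n.+1 -> exec p (setr v1 i n) v2 ->
    exec (Loop i p) v2 v3 -> exec (Loop i p) v1 v3.

(** For loops whose body leaves the counter alone: [st k] is the state before pass [k], and the body
    starts with the counter already decremented. *)
Lemma exec_loop_iter i p n (st : nat -> regs) :
  (forall k, k <= n -> st k i = n - k) ->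
  (forall k, k < n -> exec p (setr (st k) i (n - k.+1)) (st k.+1)) ->
  exec (Loop i p) (st 0) (st n).
Proof.
move=> sti stS.
suff H d : d <= n -> exec (Loop i p) (st (n - d)) (st n).
  by have := H n (leqnn n); rewrite subnn.
elim: d => [|d IHd] dn.
  by rewrite subn0; apply: ExecLoop0; rewrite sti ?subnn.
have lt : n - d.+1 < n by lia.
apply: (@ExecLoopS _ _ _ (st (n - d)) _ d).
- by rewrite sti; lia.
- have := stS _ lt; have -> : (n - d.+1).+1 = n - d by lia.
  by have -> : n - (n - d) = d by lia.
- by apply: IHd; lia.
Qed.

Definition clear i := Loop i Skip.

Definition move_reg i j := Loop i (Incr j).

(** Reading a register empties it, so its content also goes to the scratch register [t], from which
    it is restored. *)
Definition copy_reg i j t := Seq (Loop i (Seq (Incr j) (Incr t))) (move_reg t i).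

Lemma setr_id v i : setr v i (v i) = v.
Proof. by apply: functional_extensionality => j; rewrite /setr; case: eqP => [->|]. Qed.

Lemma setr_eq v i n : setr v i n i = n.
Proof. by rewrite /setr eqxx. Qed.

Lemma setr_neq v i j n : j != i -> setr v i n j = v j.
Proof. by rewrite /setr => /negbTE->. Qed.

Lemma setr_setr v i m n : setr (setr v i m) i n = setr v i n.
Proof. by apply: functional_extensionality => j; rewrite /setr; case: eqP. Qed.

Lemma exec_clear i v : exec (clear i) v (setr v i 0).
Proof.
pose st k := setr v i (v i - k).
have -> : setr v i 0 = st (v i) by rewrite /st subnn.
have {1}-> : v = st 0 by rewrite /st subn0 setr_id.
apply: exec_loop_iter => k le; first by rewrite /st setr_eq.
by rewrite /st setr_setr; apply: ExecSkip.
Qed.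

Lemma exec_move i j v : i != j -> v j = 0 ->
  exec (move_reg i j) v (setr (setr v i 0) j (v i)).
Proof.
move=> /eqP ij vj.
pose st k := setr (setr v i (v i - k)) j k.
have -> : setr (setr v i 0) j (v i) = st (v i) by rewrite /st subnn.
have {1}-> : v = st 0 by rewrite /st; regs_ext.
apply: exec_loop_iter => k le; first by rewrite /st setr_neq ?setr_eq //; apply/eqP.
have := ExecIncr j (setr (st k) i (v i - k.+1)).
by congr exec; rewrite /st; regs_ext.
Qed.

Lemma exec_copy i j t v : uniq [:: i; j; t] -> v j = 0 -> v t = 0 ->
  exec (copy_reg i j t) v (setr v j (v i)).
Proof.
rewrite /= !inE negb_or => /and3P[/andP[/eqP ij /eqP it] /eqP jt _] vj vt.
pose st k := setr (setr (setr v i (v i - k)) j k) t k.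
apply: (@ExecSeq _ _ _ (st (v i))).
  have {1}-> : v = st 0 by rewrite /st; regs_ext.
  apply: exec_loop_iter => k le; first by rewrite /st /setr; repeat case: eqP => ? //.
  have := ExecSeq (ExecIncr j (setr (st k) i (v i - k.+1))) (ExecIncr t _).
  by congr exec; rewrite /st; regs_ext.
have := @exec_move t i (st (v i)).
have -> : st (v i) i = 0 by rewrite /st /setr subnn; repeat case: eqP => //.
have -> : st (v i) t = v i by rewrite /st /setr eqxx.
move=> /(_ _ erefl); rewrite eq_sym => /(_ (introN eqP it)).
by congr exec; rewrite /st; regs_ext.
Qed.

(** [out] and all registers from [s] on must hold 0 initially, and those from
    [s] on hold 0 again at the end. *)
Fixpoint compile n (f : recfun n) (ins : seq nat) (out s : nat) : prog :=
  match f with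
  | RZero _ => Skip
  | RSucc => Seq (copy_reg (head 0 ins) out s) (Incr out)
  | RProj _ i => copy_reg (nth 0 ins i) out s
  | RComp m _ f g =>
      Seq (foldr Seq Skip
             [seq compile (g i) ins (s + i) (s + m) | i : 'I_m <- enum 'I_m])
     (Seq (compile f (iota s m) out (s + m))
          (foldr Seq Skip [seq clear j | j <- iota s m]))
  | RRec _ f g =>
      Seq (compile f (behead ins) s (s + 4))
     (Seq (copy_reg (head 0 ins) (s + 2) (s + 3))
     (Seq (Loop (s + 2)
             (Seq (compile g [:: s + 1, s & behead ins] (s + 3) (s + 4))
             (Seq (clear s) (Seq (move_reg (s + 3) s) (Incr (s + 1))))))
     (Seq (move_reg s out) (clear (s + 1)))))
  | RMin _ f =>
      let p := compile f (s :: ins) (s + 1) (s + 2) in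
      Seq p (Seq (Loop (s + 1) (Seq (clear (s + 1)) (Seq (Incr s) p)))
                 (move_reg s out))
  end.

(** Only convergent evaluations are covered; this suffices, since a decision procedure converges on
    every input of the problem. *)
Definition compiles n (f : recfun n) :=
  forall (w : n.-tuple nat) (y : nat) (ins : seq nat) (out s : nat) (v : regs),
  rec_eval f w y -> [seq v i | i <- ins] = w ->
  all (fun i => (i < s) && (i != out)) ins -> out < s -> v out = 0 ->
  (forall j, s <= j -> v j = 0) ->
  exec (compile f ins out s) v (setr v out y).

Lemma exec_foldr (T : Type) (F : T -> prog) (l : seq T) (st : nat -> regs) x0 :
  (forall k, k < size l -> exec (F (nth x0 l k)) (st k) (st k.+1)) ->
  exec (foldr Seq Skip (map F l)) (st 0) (st (size l)).
Proof.
elim: l st => [|a l IHl] st H /=; first exact: ExecSkip.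
apply: ExecSeq; first exact: (H 0).
by apply: (IHl (fun k => st k.+1)) => k; apply: (H k.+1).
Qed.

Lemma compile_proj n (i : 'I_n) : compiles (RProj i).
Proof.
move=> w y ins out s v /= -> vins insP outs vout v0.
have sz : i < size ins by rewrite -(size_map v) vins size_tuple.
have /andP[lt ne] := allP insP _ (mem_nth 0 sz).
have -> : tnth w i = v (nth 0 ins i).
  by rewrite (tnth_nth 0) -vins (nth_map 0).
apply: exec_copy => //; last exact: v0.
by rewrite /= !inE negb_or ne !neq_ltn lt outs.
Qed.

Lemma compile_succ : compiles RSucc.
Proof.
move=> w y ins out s v /= -> vins insP outs vout v0.
have sz : 0 < size ins by rewrite -(size_map v) vins size_tuple.
have /andP[lt ne] := allP insP _ (mem_nth 0 sz).
have -> : thead w = v (head 0 ins).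
  by rewrite /thead (tnth_nth 0) -vins (nth_map 0) // nth0.
rewrite nth0 in lt ne.
apply: ExecSeq.
  apply: exec_copy => //; last exact: v0.
  by rewrite /= !inE negb_or ne !neq_ltn lt outs.
have := ExecIncr out (setr v out (v (head 0 ins))).
by rewrite setr_eq setr_setr.
Qed.

Definition setrs (v : regs) s (w : seq nat) k : regs :=
  fun j => if s <= j < s + k then nth 0 w (j - s) else v j.

(** The values of the [g i] fill the registers from [s] to [s + m - 1] one after the other, and
    [setrs v s u k] is the state once [k] of them are computed. *)
Lemma compile_comp m n (f : recfun m) (g : 'I_m -> recfun n) :
  compiles f -> (forall i, compiles (g i)) -> compiles (RComp f g).
Proof.
move=> IHf IHg w y ins out s v /= [u gu fu] vins insP outs vout v0.
have setrs0 : setrs v s u 0 = v.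
  by apply: functional_extensionality => j; rewrite /setrs; case: ifP => //; lia.
have inss k : [seq setrs v s u k j | j <- ins] = [seq v j | j <- ins].
  apply/eq_in_map => j /(allP insP) /andP[js _]; rewrite /setrs.
  by case: ifP => //; lia.
have ins2 : all (fun i => (i < s + m) && (i != out)) ins.
  by apply: sub_all insP => j /andP[? ->]; rewrite andbT; lia.
apply: (@ExecSeq _ _ _ (setrs v s u m)).
  case: (posnP m) => [m0|m0].
    have -> : setrs v s u m = v by rewrite -[RHS]setrs0; congr setrs.
    rewrite (size0nil (etrans (size_enum_ord m) m0)); exact: ExecSkip.
  pose i0 := Ordinal m0.
  have -> : setrs v s u m = setrs v s u (size (enum 'I_m)) by rewrite size_enum_ord.
  rewrite -{1}setrs0.
  apply: (@exec_foldr _ _ _ (setrs v s u) i0) => k; rewrite size_enum_ord => km.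
  have nk : nth i0 (enum 'I_m) k = k :> nat by rewrite nth_enum_ord.
  set i := nth i0 _ k in nk *.
  have := IHg i w (tnth u i) ins (s + k) (s + m) (setrs v s u k) (gu _).
  rewrite inss nk => /(_ vins) H.
  have -> : setrs v s u k.+1 = setr (setrs v s u k) (s + k) (tnth u i).
    apply: functional_extensionality => j; rewrite /setr /setrs.
    case: eqP => [->|jk]; last by repeat case: ifP => //; lia.
    rewrite (tnth_nth 0) nk; case: ifP; last by lia.
    by move=> _; congr nth; lia.
  apply: H.
  - by apply: sub_all insP => j /andP[? _]; lia.
  - by lia.
  - by rewrite /setrs; case: ifP => [|_]; [lia|apply: v0; lia].
  - by move=> j sj; rewrite /setrs; case: ifP => [|_]; [lia|apply: v0; lia].
apply: (@ExecSeq _ _ _ (setr (setrs v s u m) out y)).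
  apply: IHf fu _ _ _ _ _.
  - apply: (@eq_from_nth _ 0); first by rewrite size_map size_iota size_tuple.
    move=> i; rewrite size_map size_iota => im.
    rewrite (nth_map 0) ?size_iota // nth_iota // /setrs.
    by case: ifP; [move=> _; congr nth; lia|lia].
  - by apply/allP => j; rewrite mem_iota; lia.
  - by lia.
  - by rewrite /setrs; case: ifP => //; lia.
  - by move=> j sj; rewrite /setrs; case: ifP => [|_]; [lia|apply: v0; lia].
(* The state once [k] of the intermediate values are erased. *)
pose st k : regs := fun j => if s <= j < s + k then 0 else setr (setrs v s u m) out y j.
have -> : setr v out y = st m.
  apply: functional_extensionality => j; rewrite /st /setr /setrs.
  case: eqP => [->|_]; first by case: ifP => //; lia.
  by case: ifP => sj; [rewrite v0 //; case/andP: sj|rewrite sj].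
have -> : setr (setrs v s u m) out y = st 0.
  by apply: functional_extensionality => j; rewrite /st; case: ifP => //; lia.
have {2}<- : size (iota s m) = m by rewrite size_iota.
apply: (@exec_foldr _ _ _ st 0) => k; rewrite size_iota => km.
have := exec_clear (s + k) (st k); rewrite nth_iota //; congr exec.
apply: functional_extensionality => j; rewrite /st {1}/setr.
by case: eqP => [->|?]; repeat case: ifP => //; lia.
Qed.

(** Register [s] holds the current value, [s + 1] the recursion index, [s + 2] the number of passes
    left, and [s + 3] is scratch space that receives the next value. *)
Lemma compile_rec n (f : recfun n) (g : recfun n.+2) :
  compiles f -> compiles g -> compiles (RRec f g).
Proof.
move=> IHf IHg w y ins out s v /= fgy vins insP outs vout v0.
case: ins vins insP => [|i ps] vins /=; first by case: w fgy vins => -[].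
case/andP=> /andP[is_ iout] insP.
have wi : thead w = v i by rewrite /thead (tnth_nth 0) -vins.
have wps : behead_tuple w = [seq v j | j <- ps] :> seq nat by rewrite /= -vins.
move: fgy; rewrite wi; move: (behead_tuple w) wps => p wps.
set loop := (X in X (v i) y -> _) => ly.
(* The nested existentials of [loop] are collected into the sequence of intermediate values. *)
have [acc [acc0 accS accy]] : exists acc : nat -> nat, [/\ rec_eval f p (acc 0),
    forall k, k < v i -> rec_eval g (cons_tuple k (cons_tuple (acc k) p)) (acc k.+1) &
    acc (v i) = y].
  elim: (v i) y ly => [|k IH] z; first by move=> /= fz; exists (fun=> z).
  case=> z' /IH [acc [acc0 accS accz]] gz.
  exists (fun j => if j <= k then acc j else z); split=> //; last by rewrite ltnn.
  move=> j; rewrite ltnS => jk; rewrite jk; case: ifP => jk'; first exact: accS.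
  by have -> : j = k; [lia|rewrite accz].
pose st k := setr (setr (setr v s (acc k)) (s + 1) k) (s + 2) (v i - k).
have psst u : (forall j, j < s -> u j = v j) -> [seq u j | j <- ps] = p.
  by move=> uv; rewrite wps; apply/eq_in_map => j /(allP insP)/andP[js _]; apply: uv.
apply: (@ExecSeq _ _ _ (setr v s (acc 0))).
  apply: IHf acc0 _ _ _ _ _ => //.
  - by apply: sub_all insP => j /andP[js jo]; lia.
  - by lia.
  - by apply: v0.
  - by move=> j js; apply: v0; lia.
apply: (@ExecSeq _ _ _ (st 0)).
  have := @exec_copy i (s + 2) (s + 3) (setr v s (acc 0)).
  have -> : uniq [:: i; s + 2; s + 3] by rewrite /= !inE; lia.
  have -> : setr v s (acc 0) i = v i by rewrite setr_neq; lia.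
  have s0 d : setr v s (acc 0) (s + d.+1) = 0 by rewrite setr_neq ?v0; lia.
  move=> /(_ isT (s0 _) (s0 _)).
  congr exec; rewrite /st; regs_ext; apply: v0; lia.
apply: (@ExecSeq _ _ _ (st (v i))).
  apply: exec_loop_iter => k ki; first by rewrite /st setr_eq.
  set u := setr _ _ _.
  apply: (@ExecSeq _ _ _ (setr u (s + 3) (acc k.+1))).
    apply: IHg (accS _ ki) _ _ _ _ _.
    - rewrite /= psst; last by move=> j js; rewrite /u /st !setr_neq //; lia.
      have -> : u (s + 1) = k by rewrite /u /st /setr; repeat case: eqP => //; lia.
      by have -> : u s = acc k by rewrite /u /st /setr; repeat case: eqP => //; lia.
    - rewrite /=; apply/and3P; split; try lia.
      by apply: sub_all insP => j /andP[js jo]; lia.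
    - by lia.
    - by rewrite /u /st !setr_neq ?v0; lia.
    - by move=> j sj; rewrite /u /st !setr_neq ?v0; lia.
  apply: ExecSeq (exec_clear _ _) _.
  apply: ExecSeq (exec_move _ _) _; try by [lia|rewrite setr_eq].
  set u' := setr _ _ _.
  have := ExecIncr (s + 1) u'; congr exec; rewrite /u' /u /st; regs_ext.
  by rewrite v0 //; lia.
apply: ExecSeq (exec_move _ _) _; first by lia.
  by rewrite /st !setr_neq //; lia.
have := exec_clear (s + 1) (setr (setr (st (v i)) s 0) out (st (v i) s)).
congr exec; rewrite /st; regs_ext; rewrite ?subnn v0 //; lia.
Qed.

(** Register [s] holds the candidate and [s + 1] the value of [f] at it, so the loop on [s + 1]
    stops at the first zero. *)
Lemma compile_min n (f : recfun n.+1) : compiles f -> compiles (RMin f).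
Proof.
move=> IHf w y ins out s v /= [fy fz] vins insP outs vout v0.
(* A value of [f] at each candidate: chosen, and positive, below [y], and 0 at [y]. *)
pose t z := if z < y
  then (epsilon (inhabits 0) (fun u => rec_eval f (cons_tuple z w) u.+1)).+1 else 0.
have ft z : z <= y -> rec_eval f (cons_tuple z w) (t z).
  rewrite leq_eqVlt => /predU1P[->|zy]; first by rewrite /t ltnn.
  by rewrite /t zy; apply: epsilon_spec (fz _ zy).
have tS z : z < y -> exists u, t z = u.+1 by move=> zy; rewrite /t zy; eexists.
pose st z := setr (setr v s z) (s + 1) (t z).
have insst u : (forall j, j < s -> u j = v j) -> [seq u j | j <- ins] = w.
  by move=> uv; rewrite -vins; apply/eq_in_map => j /(allP insP)/andP[js _]; apply: uv.
have run u z : (forall j, j < s -> u j = v j) -> u s = z ->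
    (forall j, s < j -> u j = 0) -> z <= y ->
    exec (compile f (s :: ins) (s + 1) (s + 2)) u (setr u (s + 1) (t z)).
  move=> uv us u0 zy; apply: IHf (ft _ zy) _ _ _ _ _.
  - by rewrite /= us insst.
  - rewrite /=; apply/andP; split; first by lia.
    by apply: sub_all insP => j /andP[js jo]; lia.
  - by lia.
  - by apply: u0; lia.
  - by move=> j js; apply: u0; lia.
apply: (@ExecSeq _ _ _ (st 0)).
  have := @run v 0; rewrite v0 // => /(_ _ erefl _ (leq0n _)) H.
  have -> : st 0 = setr v (s + 1) (t 0) by rewrite /st; regs_ext; rewrite v0.
  by apply: H => // j sj; rewrite v0 // ltnW.
apply: (@ExecSeq _ _ _ (st y)).
  (* The predecessor of [t z] appears because [Loop] has decremented the register before running the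
     body. *)
  have stS : forall z, z < y ->
      exec (Seq (clear (s + 1)) (Seq (Incr s) (compile f (s :: ins) (s + 1) (s + 2))))
        (setr (st z) (s + 1) (t z).-1) (st z.+1).
    move=> z zy; apply: ExecSeq (exec_clear _ _) _; apply: ExecSeq (ExecIncr _ _) _.
    set u := setr (setr (setr _ _ _) _ _) _ _.
    have uE : u = setr v s z.+1.
      by rewrite /u /st; regs_ext; rewrite v0 //; lia.
    have := @run u z.+1; rewrite uE setr_eq.
    have -> : setr (setr v s z.+1) (s + 1) (t z.+1) = st z.+1 by [].
    apply=> // [j js|j js]; first by rewrite setr_neq //; lia.
    by rewrite setr_neq ?v0 //; lia.
  (* The body recomputes the loop register, so [exec_loop_iter] does not apply; the induction is on
     the number of candidates left. *)
  have loop d : d <= y -> exec (Loop (s + 1)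
     (Seq (clear (s + 1)) (Seq (Incr s) (compile f (s :: ins) (s + 1) (s + 2)))))
     (st (y - d)) (st y).
    elim: d => [|d IHd] dy.
      by rewrite subn0; apply: ExecLoop0; rewrite /st setr_eq /t ltnn.
    have zy : y - d.+1 < y by lia.
    have [u tu] := tS _ zy.
    apply: (@ExecLoopS _ _ _ (st (y - d)) _ u); first by rewrite /st setr_eq.
      by have := stS _ zy; rewrite tu /=; have -> : (y - d.+1).+1 = y - d by lia.
    by apply: IHd; lia.
  by have := loop y (leqnn y); rewrite subnn.
have := @exec_move s out (st y).
have -> : st y out = 0 by rewrite /st !setr_neq //; lia.
have -> : st y s = y by rewrite /st setr_neq ?setr_eq //; lia.
have ty : t y = 0 by rewrite /t ltnn.
move=> /(_ _ erefl) H; have {}H := H ltac:(lia); move: H; congr exec.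
by rewrite /st ty; regs_ext; rewrite v0 //; lia.
Qed.

Theorem compileP n (f : recfun n) : compiles f.
Proof.
elim: f => {n} [n||n i|m n f IHf g IHg|n f IHf g IHg|n f IHf].
- by move=> w y ins out s v /= -> _ _ _ vout _; rewrite -vout setr_id; apply: ExecSkip.
- exact: compile_succ.
- exact: compile_proj.
- exact: compile_comp.
- exact: compile_rec.
- exact: compile_min.
Qed.

(** * Counter machines *)

Inductive instr :=
| Inc (i : nat)
| Dec (i b : nat)
| Jmp (b : nat).

Definition config := (nat * regs)%type.

Definition step (P : seq instr) (c : config) : config :=
  let: (a, v) := c in
  match onth P a with
  | Some (Inc i) => (a.+1, setr v i (v i).+1)
  | Some (Dec i b) => if v i is n.+1 then (a.+1, setr v i n) else (b, v)
  | Some (Jmp b) => (b, v)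
  | None => c
  end.

Definition reach (P : seq instr) (c d : config) := exists n, iter n (step P) c = d.

(** Halting is arrival just past the last instruction; being stuck at a larger address does not
    count. *)
Definition halts (P : seq instr) (c : config) := exists v, reach P c (size P, v).

Lemma reach_refl P c : reach P c c.
Proof. by exists 0. Qed.

Lemma reach_step P c d : reach P (step P c) d -> reach P c d.
Proof. by case=> n <-; exists n.+1; rewrite iterSr. Qed.

Lemma reach_trans P c d e : reach P c d -> reach P d e -> reach P c e.
Proof. by case=> m <- [n <-]; exists (n + m); rewrite iterD. Qed.

Lemma step_halt P v : step P (size P, v) = (size P, v).
Proof. by rewrite /step onth_default. Qed.

(** Final configurations are fixed by [step]. In the countermodel, this equivalence lets a
    configuration and its successor share a status. *)
Lemma halts_step P c : halts P (step P c) <-> halts P c.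
Proof.
split=> [[v /reach_step] |]; first by exists v.
case=> v [[|n]]; last by rewrite iterSr; exists v, n.
by move=> /= ->; exists v, 0; rewrite step_halt.
Qed.

Lemma halts_reach P c d : reach P c d -> halts P c <-> halts P d.
Proof.
by case=> n <-; elim: n => // n IHn; rewrite IHn iterS; split=> /halts_step.
Qed.

Lemma halts_loop P a v : a < size P -> step P (a, v) = (a, v) -> ~ halts P (a, v).
Proof.
move=> aP ea [w [n]]; have -> : iter n (step P) (a, v) = (a, v).
  by elim: n => //= n ->.
by case=> aE; rewrite aE ltnn in aP.
Qed.

(** Jumps are absolute, so [a] is the address at which the code is placed; the exit of a loop skips
    its [Dec], its body and its [Jmp]. *)
Fixpoint flat (p : prog) (a : nat) : seq instr :=
  match p with
  | Skip => [::]
  | Incr i => [:: Inc i]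
  | Seq p q => let c := flat p a in c ++ flat q (a + size c)
  | Loop i p => let c := flat p a.+1 in
      Dec i (a + size c).+2 :: rcons c (Jmp a)
  end.

(** The surrounding code [P1] and [P2] is arbitrary so that the induction can run each subprogram in
    place. *)
Lemma flatP P1 P2 p v w : exec p v w ->
  let c := flat p (size P1) in
  reach (P1 ++ c ++ P2) (size P1, v) (size P1 + size c, w).
Proof.
move=> e; elim: e P1 P2 => {p v w} /=
  [v|i v|p q v1 v2 v3 _ IHp _ IHq|i p v v0|i p v1 v2 v3 n vn _ IHp _ IHq] P1 P2.
- by rewrite addn0; apply: reach_refl.
- apply: reach_step; rewrite /= onth_cat ltnn subnn addn1; exact: reach_refl.
- rewrite -catA; apply: reach_trans (IHp _ _) _.
  have := IHq (P1 ++ flat p (size P1)) P2.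
  by rewrite size_cat -catA size_cat addnA.
- apply: reach_step; rewrite /= onth_cat ltnn subnn /= v0 size_rcons.
  by rewrite addnS addnS; apply: reach_refl.
(* One pass of the body leads back to the [Dec], where the hypothesis on the remaining iterations
   takes over. *)
- move: (IHq P1 P2) => /= {}IHq.
  set c := flat p (size P1).+1 in IHq *; set code := P1 ++ _ in IHq *.
  have codeE : code = rcons P1 (Dec i (size P1 + size c).+2) ++ c ++ Jmp (size P1) :: P2.
    by rewrite /code cat_rcons /= cat_rcons.
  have := IHp (rcons P1 (Dec i (size P1 + size c).+2)) (Jmp (size P1) :: P2).
  rewrite size_rcons -/c -codeE => H.
  have E1 : step code (size P1, v1) = ((size P1).+1, setr v1 i n).
    by rewrite /step /code onth_cat ltnn subnn /= vn.
  have E2 : step code ((size P1).+1 + size c, v2) = (size P1, v2).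
    rewrite /step codeE !onth_cat size_rcons ltnNge leq_addr /= addKn.
    by rewrite ltnn subnn.
  apply: reach_step; rewrite E1; apply: reach_trans H _.
  by apply: reach_step; rewrite E2.
Qed.

(** Falls off the end, which means halting, iff [p] leaves 0 in register [r];
    the last instruction jumps to itself. *)
Definition decider (p : prog) (r : nat) : seq instr :=
  let c := flat p 0 in
  c ++ [:: Dec r (size c).+2; Jmp (size c).+1].

Lemma decider_halts p r v w : exec p v w -> w r = 0 -> halts (decider p r) (0, v).
Proof.
move=> e wr; exists w.
apply: reach_trans (@flatP [::] [:: Dec r _; Jmp _] _ _ _ e) _; apply: reach_step.
rewrite /step /= onth_cat ltnn subnn /= wr size_cat addn2; exact: reach_refl.
Qed.

Lemma decider_loops p r v w n :
  exec p v w -> w r = n.+1 -> ~ halts (decider p r) (0, v).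
Proof.
move=> e wr; rewrite (halts_reach (@flatP [::] [:: Dec r _; Jmp _] _ _ _ e)).
rewrite add0n -halts_step /step /= onth_cat ltnn subnn /= wr.
refine (@halts_loop _ _ _ _ _); first by rewrite size_cat addn2.
by rewrite /step onth_cat ltnNge leqnSn subSnn.
Qed.

(** * Single-body rules as frontier-two inclusion dependencies *)

Definition batom := (nat * (nat * nat))%type.

(** [(A, hs)] stands for "A(0,1) implies that some 2, 3, 4, 5 satisfy [hs]". *)
Definition tgd := (nat * seq batom)%type.

(** The two variables must differ for the projection onto this atom to be an inclusion dependency
    with frontier of size two. *)
Definition batom_ok (B : nat) (h : batom) :=
  [&& h.1 < B, h.2.1 < 6, h.2.2 < 6 & h.2.1 != h.2.2].

Definition tgd_ok (B : nat) (d : tgd) := (d.1 < B) && all (batom_ok B) d.2.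

Definition tgd_sat (D : Type) (R : nat -> D -> D -> Prop) (d : tgd) :=
  forall x y, R d.1 x y ->
  exists z : nat -> D, [/\ z 0 = x, z 1 = y &
    forall h, h \in d.2 -> R h.1 (z h.2.1) (z h.2.2)].

Definition edge (r x y : nat) : atom nat := (r, [:: x; y]).

(** The relation [c], private to [d], records a whole assignment of the variables 0 to 5; the
    frontier of the first dependency is 0 and 1. *)
Definition tgd_rules (c : nat) (d : tgd) : seq rule :=
  ([:: edge d.1 0 1], [:: (c, iota 0 6)]) ::
  [seq ([:: (c, iota 0 6)], [:: edge h.1 h.2.1 h.2.2]) | h <- d.2].

Definition tgds_rules (B : nat) (ds : seq tgd) : seq rule :=
  flatten [seq tgd_rules (B + k) (nth (0, [::]) ds k) | k <- iota 0 (size ds)].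

Definition tgds_sig (B : nat) (ds : seq tgd) : signature :=
  nseq B 2 ++ nseq (size ds) 6.

Lemma edge_over B ds r x y : r < B -> atom_over (tgds_sig B ds) (edge r x y).
Proof.
move=> rB; rewrite /atom_over /arity size_cat !size_nseq nth_cat size_nseq rB nth_nseq rB.
by rewrite ltn_addr.
Qed.

Lemma tgds_rulesP B ds (r : rule) :
  reflect (exists2 k, k < size ds & r \in tgd_rules (B + k) (nth (0, [::]) ds k))
    (r \in tgds_rules B ds).
Proof.
apply: (iffP flatten_mapP) => -[k]; first by rewrite mem_iota; exists k.
by move=> kl kr; exists k; rewrite ?mem_iota.
Qed.

Lemma tgds_rules_over B ds : all (tgd_ok B) ds ->
  all (fun r => ID2 r && rule_over (tgds_sig B ds) r) (tgds_rules B ds).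
Proof.
move=> ok; apply/allP => r /tgds_rulesP[k kl].
have /andP[dB dok] := all_nthP (0, [::]) ok k kl.
have cover : atom_over (tgds_sig B ds) (B + k, iota 0 6).
  rewrite /atom_over /arity size_cat !size_nseq nth_cat size_nseq ltn_add2l kl.
  by rewrite ltnNge leq_addr addKn nth_nseq /= nth_nseq kl.
rewrite inE => /orP[/eqP->|/mapP[h /(allP dok) /and4P[hB h1 h2 h12] ->]].
  by rewrite /rule_over /= edge_over // cover.
rewrite /rule_over /= edge_over // cover /= andbT.
(* There are only 36 pairs of variables, so the check is a computation. *)
have : all (fun x => all (fun y =>
    (x != y) ==> ID2 ([:: (B + k, iota 0 6)], [:: edge h.1 x y])) (iota 0 6)) (iota 0 6) by [].
move=> /allP/(_ h.2.1); rewrite mem_iota => /(_ h1)/allP/(_ h.2.2).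
by rewrite mem_iota => /(_ h2)/implyP/(_ h12).
Qed.

Lemma tgds_complete (I : interp) B ds : all (tgd_ok B) ds ->
  (forall r, r \in tgds_rules B ds -> rule_sat I r) ->
  forall d, d \in ds -> tgd_sat (fun r x y => interp_rel (i := I) r [:: x; y]) d.
Proof.
move=> ok sat d /(nthP (0, [::]))[k kl dE] x y Rxy.
have dok := all_nthP (0, [::]) ok k kl.
rewrite dE in dok; case/andP: dok => dB dok.
have rk r : r \in tgd_rules (B + k) d -> rule_sat I r.
  by move=> rr; apply: sat; apply/tgds_rulesP; exists k; rewrite ?dE.
have [] := rk _ (mem_head _ _) (fun n => if n is 0 then x else y).
  by move=> a; rewrite inE => /eqP->.
move=> z [zf zT]; exists z; split; rewrite ?zf // => h hd.
have [] := rk ([:: (B + k, iota 0 6)], [:: edge h.1 h.2.1 h.2.2]) _ z.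
- by rewrite inE orbC; apply/orP; left; apply/mapP; exists h.
- by move=> a; rewrite inE => /eqP->; apply: zT; rewrite inE.
have /and4P[_ h1 h2 _] := allP dok _ hd.
have fr a : a < 6 -> a \in [:: h.2.1; h.2.2] ->
    a \in frontier ([:: (B + k, iota 0 6)], [:: edge h.1 h.2.1 h.2.2]).
  by move=> a6 ah; rewrite mem_undup mem_filter ah; have := mem_iota 0 6 a; rewrite a6.
move=> w [wf /(_ _ (mem_head _ _))].
by rewrite /atom_sat /= !wf //; apply: fr; rewrite // !inE eqxx ?orbT.
Qed.

Section TgdModel.

Variables (D : Type) (x0 : D) (R : nat -> D -> D -> Prop) (B : nat) (ds : seq tgd).

(** Each auxiliary relation contains all tuples that satisfy the head of its rule: the projections
    hold by definition, and [tgd_sat] supplies a tuple for the first dependency. *)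
Definition tgd_model : interp := Interp (inhabits x0) (fun r s =>
  if r < B then R r (nth x0 s 0) (nth x0 s 1)
  else forall h, h \in (nth (0, [::]) ds (r - B)).2 ->
       R h.1 (nth x0 s h.2.1) (nth x0 s h.2.2)).

Lemma tgd_model_edge r x y : r < B ->
  interp_rel (i := tgd_model) r [:: x; y] = R r x y.
Proof. by move=> /= ->. Qed.

Lemma tgd_model_sound : all (tgd_ok B) ds -> (forall d, d \in ds -> tgd_sat R d) ->
  forall r, r \in tgds_rules B ds -> rule_sat tgd_model r.
Proof.
move=> ok sat r /tgds_rulesP[k kl].
have /andP[dB dok] := all_nthP (0, [::]) ok k kl.
have {sat}/= := sat _ (mem_nth (0, [::]) kl); move: dB dok.
set d := nth _ _ _ => dB dok dsat.
have cB : (B + k < B) = false by rewrite ltnNge leq_addr.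
rewrite inE => /orP[/eqP->|/mapP[h hd ->]] v vsat.
  have := vsat _ (mem_head _ _); rewrite /atom_sat tgd_model_edge //=.
  case/dsat=> z [z0 z1 zh]; exists z; split=> [x|a].
    by rewrite !inE => /orP[] /eqP->.
  rewrite inE => /eqP->; rewrite /atom_sat /= cB addKn => h hd.
  have /and4P[_ h1 h2 _] := allP dok _ hd.
  rewrite -[[:: z 0; _; _; _; _; _]]/(map z (iota 0 6)).
  by rewrite !(nth_map 0) ?nth_iota //; apply: zh.
have /and4P[hB h1 h2 _] := allP dok _ hd.
exists v; split=> // a; rewrite inE => /eqP->.
rewrite /atom_sat tgd_model_edge //.
have := vsat _ (mem_head _ _); rewrite /atom_sat /= cB addKn => /(_ _ hd).
by rewrite -[[:: v 0; _; _; _; _; _]]/(map v (iota 0 6)) !(nth_map 0) ?nth_iota.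
Qed.

End TgdModel.

(** * Rules simulating a counter machine *)

(** [relS] relates the initial point to its status, [relB] marks the root of the
    grid, [relG] the grid points and [relZ i] those with register [i] equal to 0.
    Only the first argument matters in [relB], [relG] and [relZ]; the second one
    is there to make the frontier have size two. *)
Definition relS := 0.
Definition relB := 1.
Definition relG := 2.
Definition relH i := 3 * i.+1.
Definition relZ i := (3 * i.+1).+1.
Definition relC l := (3 * l.+1).+2.

(** [M] bounds registers and addresses alike; three marker relations are followed by three relations
    for each number below [M]. *)
Definition rel_bound M := 3 * M.+1.

(** A shared status variable links a configuration to its successor. The positive case of [Dec] is
    stated from the point after the decrement, so positivity needs no test. *)
Definition instr_tgds (a : nat) (o : instr) : seq tgd :=
  match o with
  | Inc i => [:: (relG, [:: (relH i, (0, 2)); (relC a, (0, 3)); (relC a.+1, (2, 3))])]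
  | Dec i b =>
      [:: (relG, [:: (relH i, (0, 2)); (relC a, (2, 3)); (relC a.+1, (0, 3))]);
          (relZ i, [:: (relC a, (0, 2)); (relC b, (0, 2))])]
  | Jmp b => [:: (relG, [:: (relC a, (0, 2)); (relC b, (0, 2))])]
  end.

Definition tgd_init : seq tgd :=
  [:: (relB, [:: (relG, (0, 1))]); (relS, [:: (relC 0, (0, 1))])].
Definition tgd_zero_root i : tgd := (relB, [:: (relZ i, (0, 1))]).
Definition tgd_total i : tgd := (relG, [:: (relH i, (0, 2)); (relG, (2, 3))]).
Definition tgd_comm (ij : nat * nat) : tgd :=
  (relG, [:: (relH ij.1, (0, 2)); (relH ij.2, (2, 4));
             (relH ij.2, (0, 3)); (relH ij.1, (3, 4))]).
(** A register stays 0 while another one is incremented; [machine_tgds] keeps only pairs of distinct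
    registers. *)
Definition tgd_zero (ij : nat * nat) : tgd :=
  (relZ ij.1, [:: (relH ij.2, (0, 2)); (relZ ij.1, (2, 3))]).

Definition machine_tgds (P : seq instr) (M : nat) : seq tgd :=
  let pairs := [seq (i, j) | i <- iota 0 M, j <- iota 0 M] in
  tgd_init ++ map tgd_zero_root (iota 0 M) ++ map tgd_total (iota 0 M)
  ++ map tgd_comm pairs ++ map tgd_zero [seq ij <- pairs | ij.1 != ij.2]
  ++ flatten [seq instr_tgds a (nth (Jmp 0) P a) | a <- iota 0 (size P)].

Definition instr_ok M (o : instr) : bool :=
  match o with
  | Inc i => i < M
  | Dec i b => (i < M) && (b < M)
  | Jmp b => b < M
  end.

Lemma machine_tgds_ind (P : seq instr) M (X : tgd -> Prop) :
  (forall d, d \in tgd_init -> X d) ->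
  (forall i, i < M -> X (tgd_zero_root i)) -> 
  (forall i, i < M -> X (tgd_total i)) -> 
  (forall i j, i < M -> j < M -> X (tgd_comm (i, j))) ->
  (forall i j, i < M -> j < M -> i != j -> X (tgd_zero (i, j))) ->
  (forall a d, a < size P -> d \in instr_tgds a (nth (Jmp 0) P a) -> X d) ->
  forall d, d \in machine_tgds P M -> X d.
Proof.
move=> H1 H2 H3 H4 H5 H6 d; rewrite /machine_tgds !mem_cat.
have pairP ij : (ij \in [seq (i, j) | i <- iota 0 M, j <- iota 0 M]) ->
    (ij.1 < M) && (ij.2 < M).
  by case/allpairsP => -[i j] /= [+ + ->]; rewrite !mem_iota /= => -> ->.
case/orP; first exact: H1.
case/orP; first by case/mapP => i; rewrite mem_iota => iM ->; apply: H2.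
case/orP; first by case/mapP => i; rewrite mem_iota => iM ->; apply: H3.
case/orP; first by case/mapP => -[i j] /pairP/andP[iM jM] ->; apply: H4.
case/orP.
  case/mapP => -[i j]; rewrite mem_filter => /andP[ij /pairP/andP[iM jM]] ->.
  exact: H5.
by case/flatten_mapP => a; rewrite mem_iota => aP; apply: H6.
Qed.

Lemma machine_tgds_mem (P : seq instr) M :
  [/\ {subset tgd_init <= machine_tgds P M},
      (forall i, i < M -> tgd_zero_root i \in machine_tgds P M),
      (forall i, i < M -> tgd_total i \in machine_tgds P M),
      (forall i j, i < M -> j < M -> tgd_comm (i, j) \in machine_tgds P M) &
      (forall i j, i < M -> j < M -> i != j -> tgd_zero (i, j) \in machine_tgds P M)] /\
  (forall a d, a < size P -> d \in instr_tgds a (nth (Jmp 0) P a) ->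
     d \in machine_tgds P M).
Proof.
have iotaP i : i < M -> i \in iota 0 M by rewrite mem_iota.
have pairP i j : i < M -> j < M -> (i, j) \in [seq (i, j) | i <- iota 0 M, j <- iota 0 M].
  by move=> /iotaP iM /iotaP jM; apply: allpairs_f.
split; first split.
- by move=> d dI; rewrite mem_cat dI.
- by move=> i /iotaP iM; rewrite !mem_cat (map_f tgd_zero_root) // !orbT.
- by move=> i /iotaP iM; rewrite !mem_cat (map_f tgd_total) // !orbT.
- by move=> i j iM jM; rewrite !mem_cat (map_f tgd_comm) ?pairP // !orbT.
- move=> i j iM jM ij; rewrite !mem_cat (map_f tgd_zero) ?orbT //.
  by rewrite mem_filter ij pairP.
- move=> a d aP da; rewrite !mem_cat; do 5 (apply/orP; right).
  by apply/flatten_mapP; exists a; rewrite // mem_iota.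
Qed.

Ltac names_lia :=
  rewrite /tgd_zero_root /tgd_total /tgd_comm /tgd_zero /tgd_ok /batom_ok;
  rewrite /rel_bound /relS /relB /relG /relH /relZ /relC /=; lia.

Lemma machine_tgds_ok P M : size P < M -> all (instr_ok M) P ->
  all (tgd_ok (rel_bound M)) (machine_tgds P M).
Proof.
move=> PM ok; apply/allP.
apply: machine_tgds_ind => [d|i iM|i iM|i j iM jM|i j iM jM _|a d aP].
- by rewrite !inE => /orP[]/eqP->; names_lia.
- by names_lia.
- by names_lia.
- by names_lia.
- by names_lia.
have := all_nthP (Jmp 0) ok a aP.
case: nth => [i|i b|b] /= ib; rewrite !inE; last 2 first.
- by case/orP=> /eqP->; names_lia.
- by move=> /eqP->; names_lia.
- by move=> /eqP->; names_lia.
Qed.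

(** * Runs of the machine inside a model of the rules *)

Section Simulation.

Variables (P : seq instr) (M : nat) (D : Type) (R : nat -> D -> D -> Prop).
Hypotheses (PM : size P < M) (Pok : all (instr_ok M) P).
Hypothesis Rsat : forall d, d \in machine_tgds P M -> tgd_sat R d.
Hypothesis Hfun : forall i x y y', i < M -> R (relH i) x y -> R (relH i) x y' -> y = y'.
Hypothesis Cfun : forall l x y y', l < M -> R (relC l) x y -> R (relC l) x y' -> y = y'.

Definition grid x := exists y, R relG x y.

Definition next (i : nat) (x : D) : D :=
  epsilon (inhabits x) (fun u => R (relH i) x u /\ grid u).

Lemma nextP i x : i < M -> grid x -> R (relH i) x (next i x) /\ grid (next i x).
Proof.
move=> iM [y xy]; have [[_ _ tot _ _] _] := machine_tgds_mem P M.
have [z [z0 _ zh]] := Rsat (tot i iM) xy.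
have ex : exists u, R (relH i) x u /\ grid u.
  exists (z 2); split.
    by rewrite -z0; apply: (zh (relH i, (0, 2))); rewrite inE eqxx.
  by exists (z 3); apply: (zh (relG, (2, 3))); rewrite !inE eqxx orbT.
exact: epsilon_spec ex.
Qed.

(** Functionality identifies the successors invented by different rules with a single one. *)
Lemma next_eq i x u : i < M -> grid x -> R (relH i) x u -> u = next i x.
Proof. by move=> iM /(nextP iM)[xn _] xu; apply: Hfun xu xn. Qed.

Lemma nextC i j x : i < M -> j < M -> grid x -> next i (next j x) = next j (next i x).
Proof.
move=> iM jM gx; have [y xy] := gx.
have [[_ _ _ comm _] _] := machine_tgds_mem P M.
have [z [z0 _ zh]] := Rsat (comm i j iM jM) xy.
have := zh (relH i, (0, 2)); rewrite !inE eqxx /= z0 => /(_ isT) /(next_eq iM gx) E2.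
have := zh (relH j, (0, 3)); rewrite !inE eqxx !orbT /= z0 => /(_ isT) /(next_eq jM gx) E3.
have := zh (relH j, (2, 4)); rewrite !inE eqxx !orbT /= E2 => /(_ isT).
move=> /(next_eq jM (nextP iM gx).2) <-.
have := zh (relH i, (3, 4)); rewrite !inE eqxx !orbT /= E3 => /(_ isT).
by move=> /(next_eq iM (nextP jM gx).2) <-.
Qed.

Variables (root yroot : D).
Hypothesis rootP : R relB root yroot.

Lemma grid_root : grid root.
Proof.
exists yroot; have [[init _ _ _ _] _] := machine_tgds_mem P M.
have [|z [<- <- zh]] := Rsat (init (relB, [:: (relG, (0, 1))]) _) rootP.
  by rewrite inE eqxx.
by apply: (zh (relG, (0, 1))); rewrite inE.
Qed.

Lemma iter_next i n x : i < M -> grid x -> grid (iter n (next i) x).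
Proof. by move=> iM gx; elim: n => //= n /(nextP iM) []. Qed.

(** The walk from the root that makes [v i] steps in direction [i], register by register; the list
    [s] is a parameter for inductions over the registers. *)
Definition point_on (s : seq nat) (v : regs) : D :=
  foldr (fun i x => iter (v i) (next i) x) root s.

Definition point := point_on (iota 0 M).

Lemma grid_point_on s v : all (fun i => i < M) s -> grid (point_on s v).
Proof.
elim: s => [_|i s IHs /= /andP[iM sM]]; first exact: grid_root.
exact: iter_next (IHs sM).
Qed.

Lemma iota_lt : all (fun i => i < M) (iota 0 M).
Proof. by apply/allP => i; rewrite mem_iota. Qed.

Lemma grid_point v : grid (point v).
Proof. exact: grid_point_on iota_lt. Qed.

(** By commutation, the additional step moves past the other registers until it joins the steps in
    direction [i]. *)
Lemma point_setr i v : i < M -> next i (point v) = point (setr v i (v i).+1).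
Proof.
move=> iM; rewrite /point.
have : i \in iota 0 M by rewrite mem_iota.
have iterC j n x : j < M -> grid x ->
      next i (iter n (next j) x) = iter n (next j) (next i x).
  move=> jM gx; elim: n => //= n <-; apply: nextC => //; exact: iter_next.
elim: (iota 0 M) (iota_uniq 0 M) iota_lt => //= j s IHs /andP[js us] /andP[jM sM].
have gs := grid_point_on v sM.
rewrite inE; case: eqP => [ij _|ij /= is_].
  (* The remaining registers differ from this one, so the inner part of the walk is unchanged. *)
  subst j; rewrite setr_eq /=; congr (next i (iter _ _ _)).
  elim: s js {IHs us sM gs} => //= j s IHs; rewrite inE negb_or => /andP[ij /IHs ->].
  by rewrite setr_neq // eq_sym.
rewrite iterC // IHs // setr_neq //; by rewrite eq_sym; apply/eqP.
Qed.

Lemma point0 : point (fun=> 0) = root.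
Proof. by rewrite /point; elim: iota. Qed.

(** The mark is present at the root, and the walk to [point v] makes no step in direction [i], so
    [tgd_zero] carries the mark along. *)
Lemma zero_point i v : i < M -> v i = 0 -> exists y, R (relZ i) (point v) y.
Proof.
move=> iM vi; have [[_ zr _ _ zn] _] := machine_tgds_mem P M.
rewrite /point; elim: (iota 0 M) iota_lt => [_|j s IHs] /=.
  exists yroot; have [z [<- <- zh]] := Rsat (zr i iM) rootP.
  by apply: (zh (relZ i, (0, 1))); rewrite inE.
case/andP=> jM sM; have {IHs} Zs := IHs sM; have gs := grid_point_on v sM.
case: (eqVneq i j) => [<-|ij]; first by rewrite vi.
elim: (v j) => //= n [y xy]; have [z [z0 _ zh]] := Rsat (zn i j iM jM ij) xy.
have := zh (relH j, (0, 2)); rewrite !inE eqxx /= z0 => /(_ isT).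
move=> /(next_eq jM (iter_next _ jM gs)) E2; exists (z 3); rewrite -E2.
by apply: (zh (relZ i, (2, 3))); rewrite !inE eqxx orbT.
Qed.

(** The rule of the instruction invents a status common to both configurations, and [Cfun]
    identifies it with [c]. *)
Lemma step_sound a v c : R (relC a) (point v) c ->
  R (relC (step P (a, v)).1) (point (step P (a, v)).2) c.
Proof.
rewrite /step; case E: onth => [o|] // ac.
have aP : a < size P by rewrite -onthTE E.
have aM : a < M by lia.
have [_ /(_ a _ aP)] := machine_tgds_mem P M; rewrite (onth_nth (Jmp 0) _ _ _ E).
have := all_nthP (Jmp 0) Pok a aP; rewrite (onth_nth (Jmp 0) _ _ _ E).
case: o {E} => [i|i b|b] /= ib memd.
- have [y xy] := grid_point v; have [z [z0 _ zh]] := Rsat (memd _ (mem_head _ _)) xy.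
  have := zh (relH i, (0, 2)); rewrite !inE eqxx /= z0 => /(_ isT).
  rewrite -point_setr // => /(next_eq ib (grid_point v)) <-.
  have := zh (relC a, (0, 3)); rewrite !inE eqxx !orbT /= z0 => /(_ isT).
  move=> /(Cfun aM ac) ->.
  by apply: (zh (relC a.+1, (2, 3))); rewrite !inE eqxx !orbT.
- case/andP: ib => iM bM; case vi: (v i) => [|n] /=.
    have [y xy] := zero_point iM vi; have [z [z0 _ zh]] := Rsat (memd _ (mem_last _ _)) xy.
    have := zh (relC a, (0, 2)); rewrite !inE eqxx /= z0 => /(_ isT).
    move=> /(Cfun aM ac) ->.
    by have := zh (relC b, (0, 2)); rewrite !inE eqxx !orbT /= z0 => /(_ isT).
  (* The rule is applied at the decremented contents [w], whose successor in direction [i] is the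
     point of [v]. *)
  set w := setr v i n; have [y xy] := grid_point w.
  have [z [z0 _ zh]] := Rsat (memd _ (mem_head _ _)) xy.
  have := zh (relH i, (0, 2)); rewrite !inE eqxx /= z0 => /(_ isT).
  have wv : setr w i (w i).+1 = v by rewrite /w setr_eq setr_setr -vi setr_id.
  move=> /(next_eq iM (grid_point w)); rewrite point_setr // wv => E2.
  have := zh (relC a, (2, 3)); rewrite !inE eqxx !orbT /= E2 => /(_ isT).
  move=> /(Cfun aM ac) ->.
  by have := zh (relC a.+1, (0, 3)); rewrite !inE eqxx !orbT /= z0 => /(_ isT).
- have [y xy] := grid_point v; have [z [z0 _ zh]] := Rsat (memd _ (mem_head _ _)) xy.
  have := zh (relC a, (0, 2)); rewrite !inE eqxx /= z0 => /(_ isT).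
  move=> /(Cfun aM ac) ->.
  by have := zh (relC b, (0, 2)); rewrite !inE eqxx !orbT /= z0 => /(_ isT).
Qed.

Lemma halts_sound v c : halts P (0, v) -> R relS (point v) c ->
  exists y, R (relC (size P)) y c.
Proof.
case=> w [n nE] Sc.
have C0 : R (relC 0) (point v) c.
  have [[init _ _ _ _] _] := machine_tgds_mem P M.
  have [|z [<- <- zh]] := Rsat (init (relS, [:: (relC 0, (0, 1))]) _) Sc.
    by rewrite !inE eqxx orbT.
  by apply: (zh (relC 0, (0, 1))); rewrite inE.
suff : R (relC (iter n (step P) (0, v)).1) (point (iter n (step P) (0, v)).2) c.
  by rewrite nE; exists (point w).
elim: n {nE} => [|n]; first exact: C0.
by rewrite iterS; move: (iter n _ _) => [a u] /step_sound.
Qed.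

End Simulation.

(** * Countermodel and reduction *)

Section Countermodel.

Variables (P : seq instr) (M : nat) (p0 : regs).
Hypothesis nohalt : ~ halts P (0, p0).

Definition point_or_status := (regs + bool)%type.

(** Division by 3 decodes the numbering of the relations. A status is the truth value of halting,
    and the initial point [p0] gets [false]. *)
Definition model_rel (r : nat) (x y : point_or_status) : Prop :=
  match r %/ 3, r %% 3 with
  | 0, 0 => x = inl p0 /\ y = inr false
  | 0, 1 => x = inl (fun=> 0)
  | 0, _ => exists v, x = inl v
  | i.+1, 0 => exists2 v, x = inl v & y = inl (setr v i (v i).+1)
  | i.+1, 1 => exists2 v, x = inl v & v i = 0
  | l.+1, _ => exists v b, [/\ x = inl v, y = inr b & b <-> halts P (l, v)]
  end.

Lemma model_relS x y : model_rel relS x y = (x = inl p0 /\ y = inr false).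
Proof. by []. Qed.

Lemma model_relB x y : model_rel relB x y = (x = inl (fun=> 0)).
Proof. by []. Qed.

Lemma model_relG x y : model_rel relG x y = exists v, x = inl v.
Proof. by []. Qed.

Lemma model_relH i x y :
  model_rel (relH i) x y = exists2 v, x = inl v & y = inl (setr v i (v i).+1).
Proof. by rewrite /model_rel /relH mulKn // modnMr. Qed.

Lemma model_relZ i x y : model_rel (relZ i) x y = exists2 v, x = inl v & v i = 0.
Proof.
have [d m] : relZ i %/ 3 = i.+1 /\ relZ i %% 3 = 1 by rewrite /relZ; lia.
by rewrite /model_rel d m.
Qed.

Lemma model_relC l x y : model_rel (relC l) x y =
  exists v b, [/\ x = inl v, y = inr b & b <-> halts P (l, v)].
Proof.
have [d m] : relC l %/ 3 = l.+1 /\ relC l %% 3 = 2 by rewrite /relC; lia.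
by rewrite /model_rel d m.
Qed.

Lemma status_exists l v : exists b : bool, b <-> halts P (l, v).
Proof. by case: (classic (halts P (l, v))) => h; [exists true|exists false]. Qed.

Definition model_rels :=
  (model_relS, model_relB, model_relG, model_relH, model_relZ, model_relC).

Lemma model_tgds d : d \in machine_tgds P M -> tgd_sat model_rel d.
Proof.
move: d; apply: machine_tgds_ind => [d|i iM|i iM|i j iM jM|i j iM jM ij|a d aP].
- rewrite !inE => /orP[]/eqP-> x y /=; rewrite !model_rels => H;
    (* The list gives the values of the variables 0, 1 and so on; the default of [nth] only serves
       variables absent from the rule. The same device is used below. *)
    exists (fun n => nth x [:: x; y] n); split=> // h;
    rewrite inE => /eqP-> /=; rewrite !model_rels.
    by exists (fun=> 0).
  case: H => -> ->; exists p0, false; split=> //.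
- move=> x y /=; rewrite !model_rels => H.
  exists (fun n => nth x [:: x; y] n); split=> // h.
  rewrite inE => /eqP-> /=; rewrite !model_rels.
  by exists (fun=> 0).
- move=> x y /=; rewrite !model_rels => -[v ->].
  set u : point_or_status := inl (setr v i (v i).+1).
  exists (fun n => nth y [:: inl v; y; u; u] n); split=> // h.
  rewrite !inE => /orP[] /eqP-> /=; rewrite !model_rels; first by exists v.
  by eexists.
- move=> x y /=; rewrite !model_rels => -[v ->].
  set u2 := setr v i (v i).+1; set u3 := setr v j (v j).+1.
  exists (fun n => nth y [:: inl v; y; inl u2; inl u3; inl (setr u2 j (u2 j).+1)] n).
  split=> // h.
  rewrite !inE => /or4P[] /eqP-> /=; rewrite !model_rels; try by eexists.
  exists u3 => //; congr inl; rewrite /u2 /u3.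
  by regs_ext.
- move=> x y /=; rewrite !model_rels => -[v -> vi].
  set u := setr v j (v j).+1.
  exists (fun n => nth y [:: inl v; y; inl u; inl u] n); split=> // h.
  rewrite !inE => /orP[] /eqP-> /=; rewrite !model_rels; first by exists v.
  by exists u => //; rewrite /u setr_neq.
case E: (onth P a) => [o|]; last by move: aP; rewrite -onthTE E.
rewrite (onth_nth (Jmp 0) _ _ _ E).
have hs v : halts P (step P (a, v)) <-> halts P (a, v) := halts_step _ _.
rewrite /step E in hs; case: o E hs => [i|i b|b] E hs.
- rewrite inE => /eqP-> x y /=; rewrite !model_rels => -[v ->].
  have [c ch] := status_exists a v.
  exists (fun n => nth y [:: inl v; y; inl (setr v i (v i).+1); inr c] n); split=> // h.
  rewrite !inE => /or3P[] /eqP-> /=; rewrite !model_rels; first by exists v.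
    by exists v, c.
  by exists (setr v i (v i).+1), c; split=> //; apply: iff_trans ch (iff_sym (hs v)).
- rewrite !inE => /orP[]/eqP-> x y /=; rewrite !model_rels => -[v ->].
    have [c ch] := status_exists a.+1 v.
    exists (fun n => nth y [:: inl v; y; inl (setr v i (v i).+1); inr c] n); split=> // h.
    rewrite !inE => /or3P[] /eqP-> /=; rewrite !model_rels; first by exists v.
      exists (setr v i (v i).+1), c; split=> //; apply: iff_trans ch _.
      (* Decrementing at the successor point gives back [v]. *)
      by have := hs (setr v i (v i).+1); rewrite setr_eq setr_setr setr_id.
    by exists v, c.
  move=> vi; have [c ch] := status_exists a v.
  exists (fun n => nth y [:: inl v; y; inr c] n); split=> // h.
  have := hs v; rewrite vi => hv.
  rewrite !inE => /orP[] /eqP-> /=; rewrite !model_rels; exists v, c; split=> //.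
  exact: iff_trans ch (iff_sym hv).
- rewrite inE => /eqP-> x y /=; rewrite !model_rels => -[v ->].
  have [c ch] := status_exists a v.
  exists (fun n => nth y [:: inl v; y; inr c] n); split=> // h.
  rewrite !inE => /orP[] /eqP-> /=; rewrite !model_rels; exists v, c; split=> //.
  exact: iff_trans ch (iff_sym (hs v)).
Qed.

Lemma model_functional i x y y' :
  (model_rel (relH i) x y -> model_rel (relH i) x y' -> y = y') /\
  (model_rel (relC i) x y -> model_rel (relC i) x y' -> y = y').
Proof.
rewrite !model_rels; split.
  by move=> [v -> ->] [u [vu] ->]; rewrite vu.
move=> [v [b [-> -> bh]]] [u [c [[vu] -> ch]]]; congr inr; subst u.
by apply/idP/idP => [/bh /ch|/ch /bh].
Qed.

Lemma model_query x y z : model_rel relS x z -> ~ model_rel (relC (size P)) y z.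
Proof.
rewrite !model_rels => -[_ ->] [v [b [_ [<-] [_ H]]]].
by have /H : halts P (size P, v) by exists v; exact: reach_refl.
Qed.

End Countermodel.

(** A path spelling [w], whose variable [k] is the point reached after [k] letters. Using [iteri]
    makes its code computable by primitive recursion. *)
Definition chain (w : seq nat) (L : conjunction) : conjunction :=
  iteri (size w) (fun k => cons (edge (relH (nth 0 w k)) k k.+1)) L.

Lemma chain_nseq w n i L : chain (w ++ nseq n i) L =
  iteri n (fun k => cons (edge (relH i) (size w + k) (size w + k).+1)) (chain w L).
Proof.
have chainE m : m <= n ->
    iteri (size w + m)
      (fun k => cons (edge (relH (nth 0 (w ++ nseq n i) k)) k k.+1)) L =
    iteri m (fun k => cons (edge (relH i) (size w + k) (size w + k).+1)) (chain w L).
  elim: m => [_|m IHm mn]; last first.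
    by rewrite addnS /= IHm ?(ltnW mn) // nth_cat ltnNge leq_addr addKn nth_nseq mn.
  rewrite addn0 /chain /=; have : size w <= size w by [].
  elim: {1 3 4}(size w) => //= m IHm mw; rewrite IHm ?(ltnW mw) //.
  by rewrite nth_cat mw.
by rewrite /chain size_cat size_nseq chainE.
Qed.

Lemma mem_chain w L a : a \in chain w L <->
  a \in L \/ exists2 k, k < size w & a = edge (relH (nth 0 w k)) k k.+1.
Proof.
rewrite /chain; have : size w <= size w by [].
elim: {1 3 4}(size w) => [_|m IHm mw] /=.
  by split=> [aL|[]//]; [left|case].
rewrite inE; split=> [/orP[/eqP->|/(IHm (ltnW mw))[aL|[k km ->]]]|[aL|[k]]].
- by right; exists m.
- by left.
- by right; exists k => //; apply: ltnW.
- by apply/orP; right; apply/(IHm (ltnW mw)); left.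
- rewrite ltnS leq_eqVlt => /predU1P[->->|km aE]; first by rewrite eqxx.
  by apply/orP; right; apply/(IHm (ltnW mw)); right; exists k.
Qed.

Definition fact (w : seq nat) : conjunction :=
  chain w [:: edge relB 0 0; edge relS (size w) (size w).+1].

(** The Parikh vector of [w]: the register contents at the end of the path. *)
Definition letters (w : seq nat) : regs := fun i => count_mem i w.

Lemma letters_take w k : k < size w ->
  let v := letters (take k w) in
  letters (take k.+1 w) = setr v (nth 0 w k) (v (nth 0 w k)).+1.
Proof.
move=> kw; apply: functional_extensionality => j; rewrite /letters /setr.
rewrite (take_nth 0) // -cats1 count_cat /= addn0 eq_sym.
by case: eqP => [->|_]; rewrite ?addn1 ?addn0.
Qed.

Definition query (P : seq instr) : conjunction :=
  [:: edge relS 0 1; edge (relC (size P)) 2 1].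

Section Reduction.

Variables (L : arity_two_language) (funct : nat -> constraint L).
Hypothesis functP : forall (sig : signature) (R : nat), R < size sig -> arity sig R = 2 ->
    constraint_over sig (funct R) /\
    forall I : interp, constraint_sat I (funct R) <-> functional I R.

Variables (P : seq instr) (M : nat) (w : seq nat).
Hypotheses (PM : size P < M) (Pok : all (instr_ok M) P) (wM : all (fun i => i < M) w).

Definition machine_sig := tgds_sig (rel_bound M) (machine_tgds P M).
Definition machine_rules := tgds_rules (rel_bound M) (machine_tgds P M).
Definition machine_constraints : seq (constraint L) :=
  [seq funct (relH i) | i <- iota 0 M] ++ [seq funct (relC i) | i <- iota 0 M].

Definition machine_instance : qa_instance L :=
  (machine_sig, fact w, machine_rules, machine_constraints, query P).

Lemma bin_rel r : r < rel_bound M -> r < size machine_sig /\ arity machine_sig r = 2.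
Proof.
move=> rM; rewrite /machine_sig /arity size_cat !size_nseq nth_cat size_nseq rM nth_nseq rM.
by rewrite ltn_addr.
Qed.

Lemma relHC_bound i : i < M -> relH i < rel_bound M /\ relC i < rel_bound M.
Proof. by rewrite /relH /relC /rel_bound; lia. Qed.

Lemma small_bound r : r < 3 -> r < rel_bound M.
Proof. by rewrite /rel_bound; lia. Qed.

Lemma machine_input : qa_input ID2 machine_instance.
Proof.
split.
- apply/allP => a /mem_chain[|[k kw ->]].
    by rewrite !inE => /orP[]/eqP->; apply: edge_over; apply: small_bound.
  by apply: edge_over; case: (relHC_bound (all_nthP 0 wM k kw)).
- exact: tgds_rules_over (machine_tgds_ok PM Pok).
- move=> c; rewrite mem_cat => /orP[]/mapP[i]; rewrite mem_iota /= => /relHC_bound [hB cB] ->.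
    have [s1 s2] := bin_rel hB; exact: (functP s1 s2).1.
  have [s1 s2] := bin_rel cB; exact: (functP s1 s2).1.
- apply/allP => a; rewrite !inE => /orP[]/eqP->; apply: edge_over.
    exact: small_bound.
  by case: (relHC_bound PM).
Qed.

Lemma halts_valid : halts P (0, letters w) -> qa_valid machine_instance.
Proof.
move=> hP I v Fsat rsat csat.
pose R r x y := interp_rel (i := I) r [:: x; y].
have fH i : i < M -> functional I (relH i) /\ functional I (relC i).
  move=> iM; have [hB cB] := relHC_bound iM.
  have [s1 s2] := bin_rel hB; have [s3 s4] := bin_rel cB.
  have iI : i \in iota 0 M by rewrite mem_iota.
  split; [apply/(functP s1 s2).2|apply/(functP s3 s4).2]; apply: csat.
    by rewrite mem_cat map_f.
  by rewrite mem_cat orbC map_f.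
have Rsat := tgds_complete (machine_tgds_ok PM Pok) rsat.
have Hfun i x y y' : i < M -> R (relH i) x y -> R (relH i) x y' -> y = y'.
  by move=> iM; apply: (fH i iM).1.
have Cfun i x y y' : i < M -> R (relC i) x y -> R (relC i) x y' -> y = y'.
  by move=> iM; apply: (fH i iM).2.
have edgeF a : a \in fact w -> atom_sat v a by apply: Fsat.
have rootP : R relB (v 0) (v 0).
  by apply: (edgeF (edge relB 0 0)); apply/mem_chain; left; rewrite inE eqxx.
(* By functionality, the path of the fact follows the grid. *)
have pt k : k <= size w -> v k = point M R (v 0) (letters (take k w)).
  elim: k => [_|k IHk kw]; first by rewrite take0; symmetry; exact: point0.
  have kM := all_nthP 0 wM k kw.
  have : R (relH (nth 0 w k)) (v k) (v k.+1).
    by apply: (edgeF (edge _ k k.+1)); apply/mem_chain; right; exists k.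
  rewrite letters_take // -(point_setr Rsat Hfun rootP) // -IHk ?(ltnW kw) //.
  move/(next_eq Rsat Hfun kM); apply; rewrite IHk ?(ltnW kw) //.
  exact: (grid_point Rsat rootP).
have Sedge : R relS (v (size w)) (v (size w).+1).
  by apply: (edgeF (edge relS _ _)); apply/mem_chain; left; rewrite !inE eqxx orbT.
have startS : R relS (point M R (v 0) (letters w)) (v (size w).+1).
  by rewrite -{1}(take_size w) -pt.
have [y Cy] := halts_sound PM Pok Rsat Hfun Cfun rootP hP startS.
(* Variable 2 of the query takes the default [y], a final point with the initial status. *)
exists (fun n => nth y [:: v (size w); v (size w).+1] n) => a.
by rewrite !inE => /orP[]/eqP->.
Qed.

Lemma valid_halts : qa_valid machine_instance -> halts P (0, letters w).
Proof.
move=> valid; apply: NNPP => nohalt.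
pose R := model_rel P (letters w); pose x0 : point_or_status := inl (fun=> 0).
pose B := rel_bound M; pose ds := machine_tgds P M.
(* Path variables denote the contents of prefixes of [w]; the variable after them denotes the
   initial status, [false]. *)
pose v k : point_or_status :=
  if k <= size w then inl (letters (take k w)) else inr false.
have edgeE r x y : r < B -> interp_rel (i := tgd_model x0 R B ds) r [:: x; y] = R r x y.
  exact: tgd_model_edge.
have [|||z zq] := valid (tgd_model x0 R B ds) v.
- move=> a /mem_chain[|[k kw ->]].
    rewrite !inE => /orP[]/eqP->; rewrite /atom_sat edgeE ?small_bound //;
      rewrite /R ?model_relB ?model_relS.
      by rewrite /v take0.
    by rewrite /v leqnn ltnn take_size.
  rewrite /atom_sat edgeE; last by case: (relHC_bound (all_nthP 0 wM k kw)).
  rewrite /R model_relH; exists (letters (take k w)).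
    by rewrite /v (ltnW kw).
  by rewrite /v kw letters_take.
- apply: tgd_model_sound; first exact: machine_tgds_ok.
  exact: model_tgds.
- move=> c; rewrite mem_cat => /orP[]/mapP[i]; rewrite mem_iota /= => /relHC_bound [hB cB] ->.
    have [s1 s2] := bin_rel hB; apply/(functP s1 s2).2 => x y y'.
    by rewrite !edgeE //; have [] := model_functional P (letters w) i x y y'.
  have [s1 s2] := bin_rel cB; apply/(functP s1 s2).2 => x y y'.
  by rewrite !edgeE //; have [] := model_functional P (letters w) i x y y'.
have := zq _ (mem_head _ _); rewrite /atom_sat edgeE ?small_bound // => Sz.
have := zq _ (mem_last _ _); rewrite /atom_sat edgeE; last by case: (relHC_bound PM).
exact: model_query Sz.
Qed.

End Reduction.

(** * Computing the code of an instance *)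

Definition computable n (F : seq nat -> nat) : Prop :=
  exists f : recfun n, forall v : n.-tuple nat, rec_eval f v (F v).

Lemma computable_ext n F G : (forall s, size s = n -> F s = G s) ->
  computable n F -> computable n G.
Proof. by move=> FG [f fF]; exists f => v; rewrite -FG ?size_tuple. Qed.

Lemma computable_nth n i : i < n -> computable n (fun s => nth 0 s i).
Proof.
by move=> lt; exists (RProj (Ordinal lt)) => v /=; rewrite (tnth_nth 0).
Qed.

Lemma computable_comp m n F (Gs : seq (seq nat -> nat)) : size Gs = m ->
  computable m F -> (forall i, i < m -> computable n (nth (fun=> 0) Gs i)) ->
  computable n (fun s => F [seq G s | G <- Gs]).
Proof.
move=> sz [f fF] cG.
have /fin_all_exists[g gP] (i : 'I_m) : exists h : recfun n,
  forall v : n.-tuple nat, rec_eval h v (nth (fun=> 0) Gs i v) by apply: cG.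
exists (RComp f g) => v /=.
have szm : size [seq G (val v) | G <- Gs] == m by rewrite size_map sz.
exists (Tuple szm); last exact: fF.
by move=> i; rewrite (tnth_nth 0) /= (nth_map (fun=> 0)) ?sz //; apply: gP.
Qed.

Lemma computable_succ n F : computable n F -> computable n (fun s => (F s).+1).
Proof.
move=> cF.
have cS : computable 1 (fun s => (head 0 s).+1).
  by exists RSucc => v /=; rewrite /thead (tnth_nth 0) nth0.
by apply: (computable_comp (Gs := [:: F]) _ cS) => // -[].
Qed.

Lemma computable_const n c : computable n (fun=> c).
Proof. by elim: c => [|c /computable_succ //]; exists (RZero n). Qed.

(** This is [RRec] with the iteration count computed by [A]: recursion on an additional first
    argument, then composition with [A] and the projections. *)
Lemma computable_iteri n A B (G : seq nat -> nat) :
  computable n A -> computable n B -> computable n.+2 G ->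
  computable n (fun s => iteri (A s) (fun k z => G [:: k, z & s]) (B s)).
Proof.
move=> cA [f fB] [g gG].
have cR : computable n.+1 (fun s =>
    iteri (head 0 s) (fun k z => G [:: k, z & behead s]) (B (behead s))).
  exists (RRec f g) => v /=; rewrite /thead (tnth_nth 0) nth0.
  elim: (head 0 v) => [|k IHk]; first exact: fB (behead_tuple v).
  by eexists; [exact: IHk | exact: gG (cons_tuple _ (cons_tuple _ (behead_tuple v)))].
pose Gs := A :: [seq nth 0 ^~ i | i <- iota 0 n].
apply: computable_ext (computable_comp (Gs := Gs) _ cR _) => [s sn||] /=.
- rewrite -map_comp (_ : map _ _ = s) //.
  apply: (@eq_from_nth _ 0); rewrite size_map size_iota // => i ilt.
  by rewrite (nth_map 0) ?size_iota // nth_iota.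
- by rewrite size_map size_iota.
- case=> [|i] //; rewrite ltnS => lt /=.
  rewrite (nth_map 0) ?size_iota // nth_iota //; exact: computable_nth.
Qed.

(** Lets the step function of an iteration, which has two additional arguments in front, use
    functions of the parameters. *)
Lemma computable_drop n d F : computable n F -> computable (d + n) (fun s => F (drop d s)).
Proof.
move=> cF; pose Gs := [seq nth 0 ^~ i | i <- iota d n].
apply: computable_ext (computable_comp (Gs := Gs) _ cF _) => [s sn||].
- congr F; apply: (@eq_from_nth _ 0).
    by rewrite !size_map size_iota size_drop sn addKn.
  move=> i; rewrite !size_map size_iota => ilt.
  by rewrite -map_comp (nth_map 0) ?size_iota //= nth_iota // nth_drop.
- by rewrite size_map size_iota.
- move=> i ilt; rewrite (nth_map 0) ?size_iota // nth_iota //.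
  by apply: computable_nth; rewrite ltn_add2l.
Qed.

Lemma computable_double n A : computable n A -> computable n (fun s => (A s).*2).
Proof.
move=> cA; have c2 : computable n.+2 (fun s => (nth 0 s 1).+2).
  by do 2 apply: computable_succ; apply: computable_nth.
apply: computable_ext (computable_iteri cA (computable_const n 0) c2) => s _ /=.
by elim: (A s) => //= k ->; rewrite doubleS.
Qed.

Lemma computable_add n A B : computable n A -> computable n B ->
  computable n (fun s => A s + B s).
Proof.
move=> cA cB; have c1 : computable n.+2 (fun s => (nth 0 s 1).+1).
  by apply: computable_succ; apply: computable_nth.
apply: computable_ext (computable_iteri cA cB c1) => s _ /=.
by elim: (A s) => //= k ->.
Qed.

(** The code that [pickle] gives to a nonempty list, from the codes of its head and tail. *)
Definition pcode a b := 2 ^ a * b.*2.+1.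

Lemma computable_pcode n A B : computable n A -> computable n B ->
  computable n (fun s => pcode (A s) (B s)).
Proof.
move=> cA cB; have c2 : computable n.+2 (fun s => (nth 0 s 1).*2).
  by apply: computable_double; apply: computable_nth.
have cB2 : computable n (fun s => (B s).*2.+1).
  by apply: computable_succ; apply: computable_double.
apply: computable_ext (computable_iteri cA cB2 c2) => s _ /=; rewrite /pcode.
by elim: (A s) => [|k]; rewrite ?mul1n //= expnS => ->; rewrite -mul2n mulnA.
Qed.

Lemma pickle_cons (T : countType) (x : T) (s : seq T) :
  pickle (x :: s) = pcode (pickle x) (pickle s).
Proof. by []. Qed.

(** A pair is pickled like a list of two entries; the empty list has code 0. *)
Definition ppair a b := pcode a (pcode b 0).

Lemma computable_ppair n A B : computable n A -> computable n B ->
  computable n (fun s => ppair (A s) (B s)).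
Proof.
by move=> cA cB; do 2 apply: computable_pcode => //; apply: computable_const.
Qed.

Lemma computable_edge n r A B : computable n A -> computable n B ->
  computable n (fun s => pickle (edge r (A s) (B s))).
Proof.
move=> cA cB; apply: (@computable_ppair n (fun=> r) (fun s => ppair (A s) (B s))).
  exact: computable_const.
exact: computable_ppair.
Qed.

Lemma computable_chain n i (W : seq nat -> seq nat) L A :
  computable n A -> computable n (fun s => size (W s)) ->
  computable n (fun s => pickle (chain (W s) (L s))) ->
  computable n (fun s => pickle (chain (W s ++ nseq (A s) i) (L s))).
Proof.
move=> cA cW cL.
have cS : computable n.+2 (fun s =>
   pcode (pickle (edge (relH i) (size (W (drop 2 s)) + nth 0 s 0)
                                (size (W (drop 2 s)) + nth 0 s 0).+1)) (nth 0 s 1)).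
  have c0 : computable n.+2 (fun s => size (W (drop 2 s)) + nth 0 s 0).
    by apply: computable_add; [apply: (computable_drop 2 cW) | apply: computable_nth].
  apply: computable_pcode; last exact: computable_nth.
  by apply: computable_edge => //; apply: computable_succ.
apply: computable_ext (computable_iteri cA cL cS) => s _ /=.
rewrite chain_nseq drop0; elim: (A s) => [|k IHk] //.
by rewrite !iteriS pickle_cons IHk.
Qed.

(** The first [k] entries of [s] written in unary, entry [i] with the letter [i], so that its Parikh
    vector loads them into the registers. *)
Fixpoint word (k : nat) (s : seq nat) : seq nat :=
  if k is i.+1 then word i s ++ nseq (nth 0 s i) i else [::].

Lemma computable_size_word n k : k <= n -> computable n (fun s => size (word k s)).
Proof.
elim: k => [_|k IHk kn]; first exact: computable_const.
apply: computable_ext (computable_add (IHk (ltnW kn)) (computable_nth kn)) => s _.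
by rewrite size_cat size_nseq.
Qed.

(** The final atoms depend on the length of the whole word, so they stay fixed as [L] while the
    induction adds one block of letters at a time. *)
Lemma computable_fact n : computable n (fun s => pickle (fact (word n s))).
Proof.
pose L s := [:: edge relB 0 0; edge relS (size (word n s)) (size (word n s)).+1].
suff chainP k : k <= n -> computable n (fun s => pickle (chain (word k s) (L s))).
  exact: chainP n (leqnn n).
elim: k => [_|k IHk kn].
  have cE1 : computable n (fun=> pickle (edge relB 0 0)).
    by apply: computable_edge; apply: computable_const.
  have cE2 : computable n (fun s => pickle (edge relS (size (word n s)) (size (word n s)).+1)).
    by apply: computable_edge; [|apply: computable_succ]; apply: computable_size_word.
  exact: computable_pcode cE1 (computable_pcode cE2 (computable_const n 0)).
exact: computable_chain (computable_nth kn) (computable_size_word (ltnW kn)) (IHk (ltnW kn)).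
Qed.

Lemma letters_word k s : letters (word k s) = fun i => if i < k then nth 0 s i else 0.
Proof.
apply: functional_extensionality => i; elim: k => //= k IHk.
rewrite /letters count_cat -[count_mem i _]/(letters (word k s) i) IHk count_nseq /=.
by rewrite ltnS; case: ltngtP => [||->]; rewrite ?eqxx; lia.
Qed.

Lemma word_lt k s : all (fun i => i < k) (word k s).
Proof.
elim: k => //= k IHk; rewrite all_cat all_nseq ltnSn orbT andbT.
by apply: sub_all IHk => i; apply: leqW.
Qed.

(** A bound above 3 makes room for the four input registers. *)
Lemma program_bound (P : seq instr) :
  exists M, [/\ size P < M, all (instr_ok M) P & 3 < M].
Proof.
have mono o m n : m <= n -> instr_ok m o -> instr_ok n o.
  by case: o => [i|i b|b] /= mn; lia.
elim: P => [|o P [M [PM Pok M3]]]; first by exists 4.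
have [b ob] : exists b, instr_ok b o.
  by case: o => [i|i b|b]; [exists i.+1|exists (maxn i b).+1|exists b.+1]; rewrite /=; lia.
exists (M + b).+1; split; [by rewrite /=; lia| |by lia].
rewrite /= (mono o b) //; last by lia.
by apply: sub_all Pok => x; apply: mono; lia.
Qed.

(** * Diagonalisation against a decision procedure *)

Lemma functionality_undecidable (L : arity_two_language) :
  features_functionality L -> qa_undecidable ID2 L.
Proof.
move=> [funct functP] [f fdec].
have c4 i : i < 4 -> computable 4 (fun s => nth 0 s i) by apply: computable_nth.
(* From the codes of the four other components, [code] computes that of the instance; only the fact
   has to be built. *)
have [code codeP] := computable_ppair (computable_ppair (computable_ppair
  (computable_ppair (c4 0 isT) (computable_fact 4)) (c4 1 isT)) (c4 2 isT)) (c4 3 isT).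
(* Inputs in registers 0 to 3, output in 4, scratch space from 5 on. *)
pose p := compile (RComp f (fun=> code)) (iota 0 4) 4 5.
pose P := decider p 4.
have [M [PM Pok M3]] := program_bound P.
(* [P] is fixed before its own codes are formed, and they reach it only through the fact, so no
   recursion theorem is involved. *)
pose w4 : 4.-tuple nat := [tuple pickle (machine_sig P M); pickle (machine_rules P M);
   pickle (machine_constraints funct M); pickle (query P)].
pose w := word 4 w4.
have wM : all (fun i => i < M) w.
  by apply: sub_all (word_lt 4 w4) => i i4; lia.
pose x := machine_instance funct P M w.
have xcode : pickle x =
    ppair (ppair (ppair (ppair (nth 0 w4 0) (pickle (fact (word 4 w4))))
      (nth 0 w4 1)) (nth 0 w4 2)) (nth 0 w4 3) by [].
have run y : rec_eval f [tuple pickle x] y ->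
    exec p (letters w) (setr (letters w) 4 y).
  move=> fy; apply: (@compileP _ (RComp f (fun=> code)) w4) => //.
  - exists [tuple pickle x] => // i.
    rewrite (ord1 i) (tnth_nth 0) [nth _ _ _]/= xcode; exact: codeP.
  - by rewrite /w letters_word.
  - by rewrite /w letters_word.
  - by move=> j j4; rewrite /w letters_word; case: ifP => //; lia.
have [dy dn] := fdec x (machine_input functP PM Pok wM).
(* If the instance were valid, [f] would return 1 and [P] would loop, while validity makes [P]
   halt. *)
have nvx : ~ qa_valid x.
  move=> vx; apply: (decider_loops (run _ (dy vx)) (setr_eq _ _ _)).
  refine (valid_halts functP PM Pok wM vx).
(* As the instance is not valid, [f] returns 0, so [P] halts and the instance is valid after all. *)
apply: (nvx); refine (halts_valid functP PM Pok wM _).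
exact: decider_halts (run _ (dn nvx)) (setr_eq _ _ _).
Qed.

(** The guard is repeated as matrix because the fragment has no truth constant. *)
Definition gc2_funct (r : nat) : gc2 :=
  let A : atom bool := (r, [:: false; true]) in
  GAll [:: false; true] A (GLess 2 true A (GAtom A)).

Lemma gc2_features_functionality : features_functionality GC2.
Proof.
exists gc2_funct => sig r rsig ar; split.
  have oA : atom_over sig (r, [:: false; true]) by rewrite /atom_over /= rsig ar.
  by split=> //=; rewrite /gc2_atom_over oA.
move=> I; split=> [sat x y y' xy xy'|fr v].
  have [//|ne] := classic (y = y').
  (* The variable [false] is the source of the edge and [true] its target; [y] and [y'] then violate
     the bound of fewer than two targets. *)
  pose u (b : bool) := if b then y else x.
  case: (sat u u _ xy); first by case.
  exists (fun i : 'I_2 => if i == 0 :> nat then y else y'); split.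
    by move=> [[|[|i]] li] [[|[|j]] lj] //= E; try exact: val_inj; case: ne.
  by move=> i; rewrite /atom_sat /upd /=; case: eqP.
move=> w _ wA [g [gi gA]].
have E : g ord0 = g (lift ord0 ord0).
  by apply: (fr (w false)); [have [] := gA ord0|have [] := gA (lift ord0 ord0)].
by have := gi _ _ E.
Qed.

Theorem theorem3p2 :
  destructive ID2 /\
  (forall D : arity_two_language,
     features_functionality D -> qa_undecidable ID2 D).
Proof.
split; last exact: functionality_undecidable.
exact: functionality_undecidable gc2_features_functionality.
Qed.
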